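(* Let $m\ge 1$, let $A_0,\ldots,A_{m-1}\in\mathcal{M}_d(\mathbb{C})^+$ be positive definite matrices, and let $G=G(A_0,\ldots,A_{m-1})$ be their geometric mean (barycenter). Then there exists a constant $L>0$, depending only on the matrices $A_0,\ldots,A_{m-1}$, such that for every sequence $\sigma=\{\sigma_j\}_{j\in\mathbb{N}}$ of permutations of $\{0,\ldots,m-1\}$ and every $n\ge 1$, $$\delta^2\big(S_n(\mathbf{A}_\sigma),G\big)\le \frac{L}{n}.$$ In particular, $\lim_{n\to\infty}S_n(\mathbf{A}_\sigma)=G$.
   Context: $\mathbb{N}=\{1,2,3,\ldots\}$. $\mathcal{M}_d(\mathbb{C})^+$ is the set of (strictly) positive definite $d\times d$ complex Hermitian matrices, an open cone in the real vector space of selfadjoint matrices. For a piecewise smooth path $\alpha:[a,b]\to\mathcal{M}_d(\mathbb{C})^+$ its length is $L(\alpha)=\int_a^b\|\alpha^{-1/2}(t)\alpha'(t)\alpha^{-1/2}(t)\|_2\,dt$, where $\|\cdot\|_2$ is the Frobenius (Hilbert-Schmidt) norm, and $\delta(A,B)$ is the infimum of $L(\alpha)$ over piecewise smooth paths $\alpha$ connecting $A$ with $B$. The geodesic from $A$ to $B$ is $A\#_tB=A^{1/2}(A^{-1/2}BA^{-1/2})^tA^{1/2}$, $t\in[0,1]$. The geometric mean (barycenter, least square mean) of finitely many matrices $A_0,\ldots,A_{m-1}\in\mathcal{M}_d(\mathbb{C})^+$ is the unique minimizer $G(A_0,\ldots,A_{m-1})=\operatorname{argmin}_{C\in\mathcal{M}_d(\mathbb{C})^+}\sum_{j=0}^{m-1}\delta^2(A_j,C)$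 (it exists and is unique). For a sequence $A=(A_n)_{n\in\mathbb{N}}$ in $\mathcal{M}_d(\mathbb{C})^+$, the inductive means are defined by $S_1(A)=A_1$ and $S_n(A)=S_{n-1}(A)\#_{\frac1n}A_n$ for $n\ge2$. Given $A_0,\ldots,A_{m-1}$ and a sequence $\sigma=\{\sigma_j\}_{j\in\mathbb{N}}$ of permutations of $\{0,\ldots,m-1\}$, $\mathbf{A}_\sigma$ denotes the sequence $$\mathbf{A}_\sigma=(A_{\sigma_1(0)},\ldots,A_{\sigma_1(m-1)},A_{\sigma_2(0)},\ldots,A_{\sigma_2(m-1)},A_{\sigma_3(0)},\ldots,A_{\sigma_3(m-1)},\ldots),$$ indexed by $\mathbb{N}$ starting from $1$. *)

(* Defs.v *)
From HB Require Import structures.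
From mathcomp Require Import all_boot all_order all_algebra perm.
From mathcomp Require Import all_classical all_reals all_analysis.
From mathcomp Require Export complex.
Set Implicit Arguments.
Unset Strict Implicit.
Unset Printing Implicit Defensive.
Import Order.TTheory GRing.Theory Num.Theory.
Import numFieldNormedType.Exports.

Local Open Scope classical_set_scope.
Local Open Scope ring_scope.
Local Open Scope complex_scope.

Section PositiveDefinite.
Context {R : realType} {d : nat}.
Implicit Types A B M : 'M[R[i]]_d.

(* On [R[i]], [0 < z] means that [z] is real and positive. *)
Definition posdefmx A : Prop :=
  A \is hermsymmx /\
  forall v : 'rV[R[i]]_d, v != 0 ->
    0 < (v *m A *m map_mx Num.conj v^T) 0 0.

(* Real power of a matrix through its unitary diagonalization
   [A = P^-1 *m diag_mx X *m P]; for a positive definite [A] the entries of [X]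
   are real and positive. *)
Definition mxpow A (t : R) : 'M[R[i]]_d :=
  invmx (spectralmx A)
    *m diag_mx (map_mx (fun z : R[i] => (powR (complex.Re z) t)%:C)
                       (spectral_diag A))
    *m spectralmx A.

Definition frobenius_norm M : R :=
  Num.sqrt (\sum_i \sum_j (ComplexField.Normc.normc (M i j)) ^+ 2).

(* [R[i]] carries no normed-module structure over [R] in the library, so
   differentiation of a curve of complex matrices in a real parameter is done on
   the real and imaginary parts of the entries. *)
Definition mxderiv (alpha : R -> 'M[R[i]]_d) (t : R) : 'M[R[i]]_d :=
  \matrix_(i, j) ((derive1 (fun s => complex.Re (alpha s i j)) t)
               +i* (derive1 (fun s => complex.Im (alpha s i j)) t)).

Definition smooth_fun (f : R -> R) : Prop :=
  forall (n : nat) (t : R), derivable (derive1n n f) t 1.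

Definition smooth_curve (alpha : R -> 'M[R[i]]_d) : Prop :=
  forall i j, smooth_fun (fun s => complex.Re (alpha s i j)) /\
              smooth_fun (fun s => complex.Im (alpha s i j)).

(* For some partition of [[a, b]], [alpha] coincides on each closed piece with
   the restriction of a smooth curve. As consecutive pieces share an endpoint,
   [alpha] is continuous on [[a, b]]. *)
Definition piecewise_smooth (a b : R) (alpha : R -> 'M[R[i]]_d) : Prop :=
  exists2 s : seq R, itv_partition a b s &
    forall k, (k < size s)%N ->
      exists2 beta : R -> 'M[R[i]]_d, smooth_curve beta &
        {in `[nth b (a :: s) k, nth b (a :: s) k.+1], alpha =1 beta}.

(* At the breakpoints, and at [a] and [b], the value of [mxderiv alpha] is
   immaterial: these points form a null set. *)
Definition path_length (a b : R) (alpha : R -> 'M[R[i]]_d) : R :=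
  \int[lebesgue_measure]_(t in `[a, b])
    frobenius_norm
      (mxpow (alpha t) (- 2^-1) *m mxderiv alpha t *m mxpow (alpha t) (- 2^-1)).

Definition pd_path (A B : 'M[R[i]]_d) (a b : R) (alpha : R -> 'M[R[i]]_d) :
    Prop :=
  [/\ a < b, piecewise_smooth a b alpha,
      {in `[a, b], forall t, posdefmx (alpha t)},
      alpha a = A & alpha b = B].

Definition delta A B : R :=
  inf [set l | exists a b alpha,
                 pd_path A B a b alpha /\ l = path_length a b alpha].

Definition geodesic A B (t : R) : 'M[R[i]]_d :=
  mxpow A 2^-1
    *m mxpow (mxpow A (- 2^-1) *m B *m mxpow A (- 2^-1)) t
    *m mxpow A 2^-1.

(* Such a [G] exists and is unique when [0 < m] and the [A j] are positive
   definite, so [G] is a function of the [A j]. *)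
Definition is_barycenter (m : nat) (A : 'I_m -> 'M[R[i]]_d) G : Prop :=
  posdefmx G /\
  forall C, posdefmx C ->
    \sum_(j < m) (delta (A j) G) ^+ 2 <= \sum_(j < m) (delta (A j) C) ^+ 2.

(* Sequences are indexed from 1; the values of [a] and of [inductive_mean a]
   at 0 are irrelevant. *)
Fixpoint inductive_mean (a : nat -> 'M[R[i]]_d) (n : nat) : 'M[R[i]]_d :=
  match n with
  | 0%N => 1%:M
  | k.+1 => if k is 0%N then a 1%N
            else geodesic (inductive_mean a k) (a k.+1) (k.+1%:R^-1)
  end.

(* The entry of index [n = q * m + r + 1], with [r < m], is
   [A (sigma_(q + 1) r)]; [sigma 0] is not used. *)
Definition permuted_seq (m : nat) (hm : (0 < m)%N) (A : 'I_m -> 'M[R[i]]_d)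
    (sigma : nat -> {perm 'I_m}) (n : nat) : 'M[R[i]]_d :=
  A (sigma (n.-1 %/ m).+1 (Ordinal (ltn_pmod n.-1 hm))).

End PositiveDefinite.

(* Main.v *)
(** For positive definite [A] and [B] the gap
    [tr (A^-1 (A - B) B^-1 (A - B))] is invariant under congruence and dominates
    [|log A - log B|^2], while along a curve it is infinitesimally the squared
    speed.  Hence every logarithmic chart [A |-> log (X A (adj X))] is 1-Lipschitz
    for [delta], and it preserves the distances to the point [((adj X) X)^-1].
    This gives the triangle inequality, and in the chart centred at a point of
    a geodesic it gives the semiparallelogram inequality of nonpositive
    curvature, hence the variance inequality at the barycenter [G].
    With [e n = delta^2 (S_n, G)], adding up the [m] steps of a block, moving
    all base points to the beginning of the block at a cost [O(1/n)], and using
    the variance inequality, one gets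
    [(q + 1) e ((q + 1) m) <= (q - 1) e (q m) + K / (q m + 1)]; multiplied by
    [q] this telescopes to [q e (q m) = O(1)]. *)
Require Import Defs.
From HB Require Import structures.
From mathcomp Require Import all_boot all_order all_algebra perm.
From mathcomp Require Import all_classical all_reals all_analysis.
From mathcomp Require Import measurable_realfun complex.
From mathcomp Require Import ring lra.
Set Implicit Arguments.
Unset Strict Implicit.
Unset Printing Implicit Defensive.
Import Order.TTheory GRing.Theory Num.Theory.
Import numFieldNormedType.Exports.

Local Open Scope classical_set_scope.
Local Open Scope ring_scope.

(** The obstacle is a lower bound for [delta], an infimum over all piecewise smooth paths through
    noncommuting matrices. Differentiating the matrix logarithm along a curve would require a
    formula for its differential and a spectral inequality for it. The gap replaces this by a finite
    comparison: it involves only inverses, so its behaviour along a curve follows from continuity of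
    products and inverses, and its comparison with the logarithm is a scalar inequality weighted by
    the squared moduli of a unitary matrix. A chart is exact only for distances from its centre,
    which is why each metric statement chooses its own [X]. Blocks are needed since the variance
    inequality speaks of all [A j] at one common point, whereas a step of the inductive mean sees
    one [A j] from a moving base point. Within a block the permutation merely reorders a sum, so no
    constant depends on [sigma]. *)

(** * Scalar inequalities for the logarithm *)

Lemma ler_expRBexpRN (R : realType) (w : R) :
  0 <= w -> 2 * w <= expR w - expR (- w).
Proof.
move=> w0.
have D (x : R) : is_derive x 1 (fun y : R => expR y - expR (- y))
                           (expR x + expR (- x)).
  by apply: is_derive_eq; rewrite /GRing.scale /=; ring.
have [|c _] := @MVT_segment R (fun y => expR y - expR (- y))
  (fun x => expR x + expR (- x)) 0 w w0.
  apply: derivable_within_continuous => x _; apply: ex_derive; exact: D.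
rewrite /= oppr0 subrr oppr0 !addr0 => ->.
(* The derivative at [c] is a sum of two positive numbers with product 1, hence at least 2. *)
apply: ler_wpM2r => //.
have e0 := expR_gt0 c; have eN0 := expR_gt0 (- c).
have e1 : expR c * expR (- c) = 1 by rewrite -expRD subrr expR0.
have := sqr_ge0 (expR c - expR (- c)); nra.
Qed.

(** With [u = ln x - ln y] the right side is [(expR (u / 2) - expR (- (u / 2))) ^+ 2], so this is
    [2 * w <= expR w - expR (- w)] at [w = u / 2], squared. *)
Lemma sqr_lnB_le (R : realType) (x y : R) : 0 < x -> 0 < y ->
  (ln x - ln y) ^+ 2 <= (x - y) ^+ 2 / (x * y).
Proof.
wlog xy : x y / y <= x.
  move=> H x0 y0; have [/H|/ltW/H] := leP y x; first exact.
  by rewrite -(sqrrN (y - x)) -(sqrrN (ln y - ln x)) !opprB (mulrC y); apply.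
move=> x0 y0; set u := ln x - ln y.
have u0 : 0 <= u by rewrite subr_ge0 ler_ln.
pose w := u / 2.
have w0 : 0 <= w by rewrite divr_ge0.
have H := ler_expRBexpRN w0.
have H2 : u ^+ 2 <= (expR w - expR (- w)) ^+ 2.
  have -> : u = 2 * w by rewrite /w mulrC divfK.
  by rewrite lerXn2r // nnegrE; first rewrite mulr_ge0; lra.
apply: (le_trans H2).
have ew : expR w ^+ 2 = x / y.
  rewrite -expRM_natl mulrC /w -[in LHS]mulrA mulVf// mulr1 /u expRB !lnK//.
have ewN : expR (- w) ^+ 2 = y / x.
  by rewrite expRN exprVn ew invf_div.
have e1 : expR w * expR (- w) = 1 by rewrite -expRD subrr expR0.
rewrite sqrrB ew ewN e1.
suff -> : (x - y) ^+ 2 / (x * y) = x / y - 1 *+ 2 + y / x by [].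
by field; rewrite !gt_eqF.
Qed.

(** Serves the final passage from convergence in [delta] to convergence of entries. It follows from
    [1 + u <= expR u] at [u = ln x] and at its opposite. *)
Lemma normr_sub1_le_ln (R : realType) (x : R) : 0 < x -> `|ln x| <= 2^-1 ->
  `|x - 1| <= 2 * `|ln x|.
Proof.
move=> x0; have xE : x = expR (ln x) by rewrite lnK.
set u := ln x in xE * => hu.
have h1 := expR_ge1Dx u; have h2 := expR_ge1Dx (- u).
rewrite expRN -xE in h2; rewrite -xE in h1.
have [u0|u0] := leP 0 u.
  rewrite ger0_norm // in hu *.
  rewrite ger0_norm; last lra.
  have : x * (1 - u) <= 1.
    by rewrite -[leRHS](divff (lt0r_neq0 x0)) ler_wpM2l // ltW.
  nra.
have x1 : x <= 1 by rewrite xE expR_le1 ltW.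
rewrite ltr0_norm // in hu *; rewrite ler0_norm ?subr_le0//; lra.
Qed.

(* Sealed copies of the operations on complex matrices: [mulmx] and its kin
   unfold to arithmetic in [R[i]], which makes failing unification problems
   practically nonterminating. *)
HB.lock Definition cmul (R : realType) (d : nat) (A B : 'M[R[i]]_d) : 'M[R[i]]_d :=
  A *m B.
HB.lock Definition cadj (R : realType) (d : nat) (A : 'M[R[i]]_d) : 'M[R[i]]_d :=
  map_mx Num.conj A^T.
HB.lock Definition cinv (R : realType) (d : nat) (A : 'M[R[i]]_d) : 'M[R[i]]_d :=
  invmx A.
HB.lock Definition ipmx (R : realType) (d : nat) (A B : 'M[R[i]]_d) : R :=
  complex.Re (\tr (A *m map_mx Num.conj B^T)).
HB.lock Definition retr (R : realType) (d : nat) (A : 'M[R[i]]_d) : R :=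
  complex.Re (\tr A).
HB.lock Definition fnorm (R : realType) (d : nat) (A : 'M[R[i]]_d) : R :=
  frobenius_norm A.

Notation "A ** B" := (cmul A B) (at level 40, left associativity) : ring_scope.

(** * The real Frobenius inner product and its norm *)

Section Frobenius.
Context {R : realType} {d : nat}.
Local Notation C := R[i].
Local Open Scope complex_scope.
Implicit Types M N P Q U V X : 'M[C]_d.

Lemma Re_mul_conj (z : C) :
  complex.Re (z * Num.conj z) = complex.Re z ^+ 2 + complex.Im z ^+ 2.
Proof. by case: z => a b /=; rewrite mulrN opprK !expr2. Qed.

Lemma Re_sum (I : Type) (r : seq I) (p : pred I) (F : I -> C) :
  complex.Re (\sum_(i <- r | p i) F i) = \sum_(i <- r | p i) complex.Re (F i).
Proof. by elim/big_rec2: _ => [//|i a b _ <-]; case: (F i) b => x y [z t]. Qed.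

Lemma normc_sqr (z : C) :
  ComplexField.Normc.normc z ^+ 2 = complex.Re z ^+ 2 + complex.Im z ^+ 2.
Proof. by case: z => a b /=; rewrite sqr_sqrtr// addr_ge0 ?sqr_ge0. Qed.

Lemma cmulE M N i j : (M ** N) i j = \sum_k M i k * N k j.
Proof. by rewrite cmul.unlock mxE. Qed.

Lemma cadjE M i j : cadj M i j = Num.conj (M j i).
Proof. by rewrite cadj.unlock !mxE. Qed.

Lemma cmulA M N P : M ** (N ** P) = M ** N ** P.
Proof. by rewrite cmul.unlock mulmxA. Qed.

Lemma cmul1m M : 1%:M ** M = M.
Proof. by rewrite cmul.unlock mul1mx. Qed.

Lemma cmulm1 M : M ** 1%:M = M.
Proof. by rewrite cmul.unlock mulmx1. Qed.

Lemma cmulDl M N P : (M + N) ** P = M ** P + N ** P.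
Proof. by rewrite cmul.unlock mulmxDl. Qed.

Lemma cmulBl M N P : (M - N) ** P = M ** P - N ** P.
Proof. by rewrite cmul.unlock mulmxBl. Qed.

Lemma cmulBr M N P : P ** (M - N) = P ** M - P ** N.
Proof. by rewrite cmul.unlock mulmxBr. Qed.

Lemma cmulZl (a : C) M N : (a *: M) ** N = a *: (M ** N).
Proof. by rewrite cmul.unlock scalemxAl. Qed.

Lemma cmulZr (a : C) M N : M ** (a *: N) = a *: (M ** N).
Proof. by rewrite cmul.unlock scalemxAr. Qed.

Lemma cmulVm X : X \in unitmx -> cinv X ** X = 1%:M.
Proof. by move=> hX; rewrite cmul.unlock cinv.unlock mulVmx. Qed.

Lemma cmulmV X : X \in unitmx -> X ** cinv X = 1%:M.
Proof. by move=> hX; rewrite cmul.unlock cinv.unlock mulmxV. Qed.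

Lemma cmulmK X M : X \in unitmx -> M ** X ** cinv X = M.
Proof. by move=> hX; rewrite -cmulA cmulmV// cmulm1. Qed.

Lemma cmulmKV X M : X \in unitmx -> M ** cinv X ** X = M.
Proof. by move=> hX; rewrite -cmulA cmulVm// cmulm1. Qed.

Lemma cmul_unit M N : (M ** N \in unitmx) = (M \in unitmx) && (N \in unitmx).
Proof. by rewrite cmul.unlock unitmx_mul. Qed.

Lemma cinv_unit M : (cinv M \in unitmx) = (M \in unitmx).
Proof. by rewrite cinv.unlock unitmx_inv. Qed.

Lemma cmul1_unit M N : M ** N = 1%:M -> (M \in unitmx) * (N \in unitmx).
Proof. by rewrite cmul.unlock => /mulmx1_unit[]. Qed.

Lemma cmul1_cinv M N : M ** N = 1%:M -> cinv M = N.
Proof.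
move=> h; have [hM _] := cmul1_unit h.
by rewrite -[LHS]cmulm1 -h cmulA cmulVm// cmul1m.
Qed.

Lemma cinvM M N : M \in unitmx -> N \in unitmx -> cinv (M ** N) = cinv N ** cinv M.
Proof.
move=> hM hN; apply: cmul1_cinv.
by rewrite !cmulA (cmulmK _ hN) (cmulmV hM).
Qed.

Lemma cadjK M : cadj (cadj M) = M.
Proof. by apply/matrixP => i j; rewrite !cadjE conjCK. Qed.

Lemma cadjM M N : cadj (M ** N) = cadj N ** cadj M.
Proof. by rewrite cadj.unlock cmul.unlock trmx_mul map_mxM. Qed.

Lemma cadjB M N : cadj (M - N) = cadj M - cadj N.
Proof. by rewrite cadj.unlock linearB map_mxB. Qed.

Lemma cadj1 : cadj (1%:M : 'M[C]_d) = 1%:M.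
Proof. by rewrite cadj.unlock trmx1 map_mx1. Qed.

Lemma cadj_unit M : (cadj M \in unitmx) = (M \in unitmx).
Proof. by rewrite cadj.unlock map_unitmx unitmx_tr. Qed.

Lemma cadjV M : cadj (cinv M) = cinv (cadj M).
Proof. by rewrite cadj.unlock cinv.unlock trmx_inv map_invmx. Qed.

Lemma cadjZ (a : R) M : cadj (a%:C *: M) = a%:C *: cadj M.
Proof.
apply/matrixP => i j; rewrite cadjE [RHS]mxE cadjE mxE rmorphM; congr (_ * _).
exact: conjc_real.
Qed.

Lemma retrD M N : retr (M + N) = retr M + retr N.
Proof. by rewrite retr.unlock mxtraceD; case: (\tr M) (\tr N) => a b [c e]. Qed.

Lemma retr_mulC M N : retr (M ** N) = retr (N ** M).
Proof. by rewrite retr.unlock cmul.unlock mxtrace_mulC. Qed.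

Lemma ipmx_retr M N : ipmx M N = retr (M ** cadj N).
Proof. by rewrite ipmx.unlock retr.unlock cmul.unlock cadj.unlock. Qed.

Lemma ipmxE M N : ipmx M N = \sum_i \sum_j complex.Re (M i j * Num.conj (N i j)).
Proof.
rewrite ipmx_retr retr.unlock /mxtrace Re_sum; apply: eq_bigr => i _.
rewrite cmulE Re_sum.
by apply: eq_bigr => j _; rewrite cadjE.
Qed.

Lemma fnormE M : fnorm M = Num.sqrt (ipmx M M).
Proof.
rewrite fnorm.unlock /frobenius_norm ipmxE; congr Num.sqrt.
apply: eq_bigr => i _; apply: eq_bigr => j _.
by rewrite normc_sqr Re_mul_conj.
Qed.

Lemma ipmx_ge0 M : 0 <= ipmx M M.
Proof.
rewrite ipmxE; apply: sumr_ge0 => i _; apply: sumr_ge0 => j _.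
by rewrite Re_mul_conj addr_ge0 ?sqr_ge0.
Qed.

Lemma ipmxC M N : ipmx M N = ipmx N M.
Proof.
rewrite !ipmxE; apply: eq_bigr => i _; apply: eq_bigr => j _.
by case: (M i j) (N i j) => a b [c e] /=; ring.
Qed.

Lemma ipmxDl M N P : ipmx (M + N) P = ipmx M P + ipmx N P.
Proof. by rewrite !ipmx_retr cmulDl retrD. Qed.

Lemma ipmxZl (a : R) M N : ipmx (a%:C *: M) N = a * ipmx M N.
Proof.
rewrite !ipmx_retr cmulZl retr.unlock mxtraceZ; case: (\tr _) => x y /=.
by rewrite mul0r subr0.
Qed.

Lemma ipmxNl M N : ipmx (- M) N = - ipmx M N.
Proof. by rewrite -scaleN1r -(rmorphN1 (real_complex R)) ipmxZl mulN1r. Qed.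

Lemma ipmxDr M N P : ipmx P (M + N) = ipmx P M + ipmx P N.
Proof. by rewrite ipmxC ipmxDl !(ipmxC P). Qed.

Lemma ipmxZr (a : R) M N : ipmx N (a%:C *: M) = a * ipmx N M.
Proof. by rewrite ipmxC ipmxZl (ipmxC N). Qed.

Lemma ipmxNr M N : ipmx N (- M) = - ipmx N M.
Proof. by rewrite ipmxC ipmxNl (ipmxC N). Qed.

Lemma fnorm_ge0 M : 0 <= fnorm M.
Proof. by rewrite fnormE sqrtr_ge0. Qed.

Lemma fnorm_sqr M : fnorm M ^+ 2 = ipmx M M.
Proof. by rewrite fnormE sqr_sqrtr// ipmx_ge0. Qed.

Lemma normc_le_fnorm M i j : ComplexField.Normc.normc (M i j) <= fnorm M.
Proof.
rewrite -(@ler_pXn2r _ 2)// ?nnegrE ?fnorm_ge0//; last first.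
  by case: (M i j) => a b /=; exact: sqrtr_ge0.
rewrite fnorm_sqr ipmxE (bigD1 i) //= (bigD1 j) //= -addrA Re_mul_conj normc_sqr.
rewrite lerDl addr_ge0 //; first apply: sumr_ge0 => k _.
  by rewrite Re_mul_conj addr_ge0 ?sqr_ge0.
apply: sumr_ge0 => k _; apply: sumr_ge0 => l _.
by rewrite Re_mul_conj addr_ge0 ?sqr_ge0.
Qed.

Lemma fnormN M : fnorm (- M) = fnorm M.
Proof. by rewrite !fnormE ipmxNl ipmxNr opprK. Qed.

Lemma fnormZ (a : R) M : fnorm (a%:C *: M) = `|a| * fnorm M.
Proof.
rewrite !fnormE ipmxZl ipmxZr mulrA -expr2 sqrtrM ?sqr_ge0//.
by rewrite sqrtr_sqr.
Qed.

Lemma fnorm0 : fnorm (0 : 'M[C]_d) = 0.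
Proof.
by rewrite -[0](scale0r (0 : 'M[C]_d)) -(rmorph0 (real_complex R)) fnormZ normr0 mul0r.
Qed.

(** Cauchy-Schwarz, from nonnegativity of the quadratic form [q] of [s M - t N], taken at [s = b],
    [t = a]. *)
Lemma ipmx_le_fnorm M N : ipmx M N <= fnorm M * fnorm N.
Proof.
set a := fnorm M; set b := fnorm N.
have a0 : 0 <= a by exact: fnorm_ge0.
have b0 : 0 <= b by exact: fnorm_ge0.
have q (s t : R) : 0 <= s ^+ 2 * a ^+ 2 - 2 * s * t * ipmx M N + t ^+ 2 * b ^+ 2.
  have := ipmx_ge0 (s%:C *: M - t%:C *: N).
  rewrite !(ipmxDl, ipmxDr, ipmxNl, ipmxNr, ipmxZl, ipmxZr) (ipmxC N M).
  rewrite -!fnorm_sqr -/a -/b; lra.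
have [ab0|ab] := ltP 0 (a * b).
  have : 0 <= (a * b) * (a * b - ipmx M N) by have := q b a; lra.
  by rewrite pmulr_rge0// subr_ge0.
have : (a == 0) || (b == 0) by rewrite -mulf_eq0 eq_le ab mulr_ge0.
have ip0 : ipmx M N ^+ 2 <= 0 -> ipmx M N <= a * b.
  rewrite exprn_even_le0//= => /eqP->; exact: mulr_ge0.
move=> /orP[] /eqP z; apply: ip0.
(* For [a = 0] this choice of [s] and [t] leaves [0 <= - (2 + b ^+ 2) * ipmx M N ^+ 2]; the case
   [b = 0] is symmetric. *)
- have := q (1 + b ^+ 2) (ipmx M N); rewrite z.
  have := mulr_ge0 (sqr_ge0 b) (sqr_ge0 (ipmx M N)); lra.
- have := q (ipmx M N) (1 + a ^+ 2); rewrite z.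
  have := mulr_ge0 (sqr_ge0 a) (sqr_ge0 (ipmx M N)); lra.
Qed.

Lemma ler_fnormD M N : fnorm (M + N) <= fnorm M + fnorm N.
Proof.
rewrite -(@ler_pXn2r _ 2)// ?nnegrE ?addr_ge0 ?fnorm_ge0//.
rewrite sqrrD !fnorm_sqr ipmxDl !ipmxDr (ipmxC N M).
have := ipmx_le_fnorm M N; lra.
Qed.

Lemma fnormB M N : fnorm (M - N) = fnorm (N - M).
Proof. by rewrite -fnormN opprB. Qed.

Lemma ler_fnorm_dist P M N : fnorm (M - N) <= fnorm (M - P) + fnorm (P - N).
Proof.
have -> : M - N = (M - P) + (P - N) by rewrite addrA subrK.
exact: ler_fnormD.
Qed.

(** Only [cadj P ** P] and [Q ** cadj Q] enter: unitary factors disappear, and Hermitian square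
    roots combine into the matrices themselves. *)
Lemma ipmx_mul P M Q :
  ipmx (P ** M ** Q) (P ** M ** Q) =
  retr (cadj P ** P ** M ** (Q ** cadj Q) ** cadj M).
Proof. by rewrite !ipmx_retr !cadjM !cmulA retr_mulC !cmulA. Qed.

Lemma fnorm_unitary U M V : cadj U ** U = 1%:M -> V ** cadj V = 1%:M ->
  fnorm (U ** M ** V) = fnorm M.
Proof.
by move=> hU hV; rewrite !fnormE ipmx_mul hU hV cmul1m cmulm1 -ipmx_retr.
Qed.

End Frobenius.

(** * Functional calculus of Hermitian matrices *)

HB.lock Definition diagRmx (R : realType) (d : nat) (x : 'rV[R]_d) : 'M[R[i]]_d :=
  diag_mx (map_mx (real_complex R) x).
HB.lock Definition udiagmx (R : realType) (d : nat) (V : 'M[R[i]]_d) (x : 'rV[R]_d) :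
    'M[R[i]]_d :=
  cadj V ** diagRmx x ** V.
(** For Hermitian [A] the entries of [spectral_diag A] are real, so taking real parts loses
    nothing. *)
HB.lock Definition mxfun (R : realType) (d : nat) (f : R -> R) (A : 'M[R[i]]_d) :
    'M[R[i]]_d :=
  udiagmx (spectralmx A) (\row_j f (complex.Re (spectral_diag A 0 j))).

Section SpectralCalculus.
Context {R : realType} {d : nat}.
Local Notation C := R[i].
Local Open Scope complex_scope.
Implicit Types (A B M N P Q U V X : 'M[C]_d) (x y : 'rV[R]_d) (f : R -> R).

Lemma diagRmxE x i j : diagRmx x i j = (x 0 i)%:C *+ (i == j).
Proof. by rewrite diagRmx.unlock !mxE. Qed.

Lemma mul_diagRmxE x M i j : (diagRmx x ** M) i j = (x 0 i)%:C * M i j.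
Proof. by rewrite diagRmx.unlock cmul.unlock mul_diag_mx !mxE. Qed.

Lemma mul_mx_diagRmxE x M i j : (M ** diagRmx x) i j = (x 0 j)%:C * M i j.
Proof. by rewrite diagRmx.unlock cmul.unlock mul_mx_diag !mxE mulrC. Qed.

Lemma cadj_diagRmx x : cadj (diagRmx x) = diagRmx x.
Proof.
apply/matrixP => i j; rewrite cadjE !diagRmxE rmorphMn eq_sym.
by case: eqP => [->|]; rewrite ?mulr0n// !mulr1n; exact: conjc_real.
Qed.

Lemma diagRmxM x y : diagRmx x ** diagRmx y = diagRmx (\row_j (x 0 j * y 0 j)).
Proof.
apply/matrixP => i j; rewrite mul_diagRmxE !diagRmxE mxE rmorphM.
by rewrite mulrnAr; case: eqP => [->|].
Qed.

Lemma diagRmx1 : diagRmx (const_mx 1) = 1%:M :> 'M[C]_d.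
Proof. by apply/matrixP => i j; rewrite diagRmxE !mxE. Qed.

Lemma unitary_cmulV V : V \is unitarymx -> V ** cadj V = 1%:M.
Proof. by move/unitarymxP; rewrite cmul.unlock cadj.unlock. Qed.

Lemma unitary_cVmul V : V \is unitarymx -> cadj V ** V = 1%:M.
Proof.
by move/unitary_cmulV; rewrite cmul.unlock => /mulmx1C.
Qed.

Lemma unitary_cmulK V M : V \is unitarymx -> M ** V ** cadj V = M.
Proof. by move=> hV; rewrite -cmulA unitary_cmulV// cmulm1. Qed.

Lemma unitary_cmulKV V M : V \is unitarymx -> M ** cadj V ** V = M.
Proof. by move=> hV; rewrite -cmulA unitary_cVmul// cmulm1. Qed.

Lemma cadj_udiagmx V x : cadj (udiagmx V x) = udiagmx V x.
Proof. by rewrite udiagmx.unlock !cadjM cadj_diagRmx cadjK cmulA. Qed.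

Lemma udiagmxM V x y : V \is unitarymx ->
  udiagmx V x ** udiagmx V y = udiagmx V (\row_j (x 0 j * y 0 j)).
Proof.
by move=> hV; rewrite udiagmx.unlock -diagRmxM !cmulA unitary_cmulK.
Qed.

Lemma udiagmx1 V : V \is unitarymx -> udiagmx V (const_mx 1) = 1%:M.
Proof.
by move=> hV; rewrite udiagmx.unlock diagRmx1 cmulm1 unitary_cVmul.
Qed.

Lemma mxpowE A t : mxpow A t = mxfun (fun r => r `^ t) A.
Proof.
rewrite mxfun.unlock udiagmx.unlock cmul.unlock cadj.unlock diagRmx.unlock /mxpow.
rewrite (invmx_unitary (spectral_unitarymx A)); congr (_ *m diag_mx _ *m _).
by apply/rowP => j; rewrite !mxE.
Qed.

Lemma hermsymmxP A : reflect (cadj A = A) (A \is hermsymmx).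
Proof.
rewrite cadj.unlock.
apply: (iffP (is_hermitianmxP _ _ _)); rewrite expr0 scale1r => hA.
  by rewrite {2}hA.
by rewrite -{1}hA.
Qed.

Lemma spectral_decomp A : A \is hermsymmx ->
  A = cadj (spectralmx A) ** diag_mx (spectral_diag A) ** spectralmx A.
Proof.
move=> /hermitian_normalmx /orthomx_spectralP {1}->.
by rewrite (invmx_unitary (spectral_unitarymx A)) cmul.unlock cadj.unlock.
Qed.

(** The calculus does not depend on the diagonalization. The change of basis [W] intertwines the two
    diagonal matrices, so wherever [W i j] is nonzero the eigenvalues of index [i] and [j] agree,
    and so do their images under [f]. This frees all later proofs from the particular choice
    [spectralmx]. *)
Lemma mxfun_udiagmx f V x : V \is unitarymx ->
  mxfun f (udiagmx V x) = udiagmx V (map_mx f x).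
Proof.
move=> hV; set A := udiagmx V x; rewrite mxfun.unlock.
have hA : A \is hermsymmx by apply/hermsymmxP; exact: cadj_udiagmx.
have hP := spectral_unitarymx A; have := spectral_decomp hA.
set P := spectralmx A in hP *; set D := spectral_diag A => hD.
set z := (\row_j _).
pose W := P ** cadj V.
have hW : diag_mx D ** W = W ** diagRmx x.
  have -> : diag_mx D ** W = P ** A ** cadj V.
    by rewrite hD /W !cmulA unitary_cmulV// cmul1m.
  by rewrite /A udiagmx.unlock /W !cmulA unitary_cmulK.
have hfW : diagRmx z ** W = W ** diagRmx (map_mx f x).
  apply/matrixP => i j; rewrite mul_diagRmxE mul_mx_diagRmxE.
  have /matrixP/(_ i j) := hW; rewrite mul_mx_diagRmxE cmul.unlock mul_diag_mx mxE.
  have [->|W0] := eqVneq (W i j) 0; first by rewrite !mulr0.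
  by move/(mulIf W0); rewrite !mxE => ->.
rewrite udiagmx.unlock.
have -> : cadj P ** diagRmx z ** P = cadj P ** (diagRmx z ** W) ** V.
  by rewrite /W !cmulA unitary_cmulKV.
by rewrite hfW /W !cmulA unitary_cVmul// cmul1m.
Qed.

Lemma posdefmx_congr X A : X \in unitmx -> posdefmx A ->
  posdefmx (X ** A ** cadj X).
Proof.
move=> hX [/hermsymmxP hA pA]; split.
  by apply/hermsymmxP; rewrite !cadjM cadjK hA cmulA.
move=> v v0.
have w0 : v *m X != 0.
  by apply: contra_neq v0 => h; rewrite -[v](mulmxK hX) h mul0mx.
have := pA _ w0; rewrite cmul.unlock cadj.unlock trmx_mul map_mxM !mulmxA; exact.
Qed.

Lemma posdefmx1 : posdefmx (1%:M : 'M[C]_d).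
Proof.
split; first by apply/hermsymmxP; exact: cadj1.
by move=> v v0; rewrite mulmx1 -dotmxE; exact: dotmx_is_dotmx.
Qed.

(** Exhibits the matrix as a congruence of the identity, from which positivity is inherited. *)
Lemma udiagmx_sqrE V x : (forall j, 0 < x 0 j) ->
  udiagmx V x = (cadj V ** diagRmx (map_mx Num.sqrt x)) ** 1%:M **
                cadj (cadj V ** diagRmx (map_mx Num.sqrt x)).
Proof.
move=> hx; rewrite cmulm1 cadjM cadj_diagRmx cadjK !cmulA udiagmx.unlock.
rewrite -[_ ** diagRmx _ ** diagRmx _]cmulA diagRmxM.
congr (_ ** diagRmx _ ** _).
by apply/rowP => j; rewrite !mxE -expr2 sqr_sqrtr// ltW.
Qed.

Lemma diagRmx_unit x : (forall j, x 0 j != 0) -> diagRmx x \in unitmx.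
Proof.
move=> hx; suff /cmul1_unit[] : diagRmx x ** diagRmx (map_mx GRing.inv x) = 1%:M by [].
rewrite diagRmxM -diagRmx1; congr diagRmx; apply/rowP => j.
by rewrite !mxE divff.
Qed.

Lemma udiagmx_unit V x : V \is unitarymx -> (forall j, x 0 j != 0) ->
  udiagmx V x \in unitmx.
Proof.
move=> hV hx; rewrite udiagmx.unlock !cmul_unit cadj_unit diagRmx_unit//.
by rewrite unitarymx_unit.
Qed.

Lemma posdefmx_udiagmx V x : V \is unitarymx -> (forall j, 0 < x 0 j) ->
  posdefmx (udiagmx V x).
Proof.
move=> hV hx; rewrite udiagmx_sqrE//; apply: posdefmx_congr posdefmx1.
rewrite cmul_unit cadj_unit unitarymx_unit//=; apply: diagRmx_unit => j.
by rewrite mxE gt_eqF// sqrtr_gt0.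
Qed.

Lemma posdefmxP A : posdefmx A ->
  exists V x, [/\ V \is unitarymx, forall j, 0 < x 0 j & A = udiagmx V x].
Proof.
move=> [hA pA]; have hP := spectral_unitarymx A.
have hD := spectral_decomp hA.
set P := spectralmx A in hP hD *; set D := spectral_diag A in hD *.
(* The eigenvalue is the value of the form at row [j] of the unitary [P], a nonzero vector. *)
have D0 j : 0 < D 0 j.
  have Pj0 : row j P != 0.
    apply/eqP => h; have := unitary_cmulV hP.
    move=> /matrixP/(_ j j); rewrite cmulE big1 => [|k _].
      by rewrite mxE eqxx => /eqP; rewrite eq_sym oner_eq0.
    by have /rowP/(_ k) := h; rewrite !mxE => ->; rewrite mul0r.
  have := pA _ Pj0.
  suff -> : (row j P *m A *m map_mx Num.conj (row j P)^T) 0 0 = D 0 j by [].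
  transitivity ((P ** A ** cadj P) j j).
    rewrite cmulE mxE; apply: eq_bigr => k _; rewrite !mxE cadjE; congr (_ * _).
    by rewrite cmulE; apply: eq_bigr => l _; rewrite mxE.
  rewrite hD !cmulA unitary_cmulV// cmul1m unitary_cmulK//.
  by rewrite mxE eqxx mulr1n.
exists P, (\row_j complex.Re (D 0 j)); split => // [j|].
  by rewrite mxE; have := D0 j; rewrite ltcE /= => /andP[_].
rewrite {1}hD udiagmx.unlock; congr (_ ** _ ** _).
apply/matrixP => i j; rewrite diagRmxE !mxE; congr (_ *+ _).
by rewrite RRe_real// gtr0_real.
Qed.

Lemma posdefmx_unit A : posdefmx A -> A \in unitmx.
Proof.
move=> /posdefmxP[V [x [hV hx ->]]]; apply: udiagmx_unit => // j.
by rewrite gt_eqF.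
Qed.

Lemma posdefmx_cadj A : posdefmx A -> cadj A = A.
Proof. by case=> /hermsymmxP. Qed.

Lemma cinv_udiagmx V x : V \is unitarymx -> (forall j, x 0 j != 0) ->
  cinv (udiagmx V x) = udiagmx V (map_mx GRing.inv x).
Proof.
move=> hV hx; apply: cmul1_cinv; rewrite udiagmxM// -(udiagmx1 hV).
by congr udiagmx; apply/rowP => j; rewrite !mxE divff.
Qed.

Lemma ipmx_weighted (a : 'I_d -> 'I_d -> R) M N :
  (forall i j, M i j = (a i j)%:C * N i j) ->
  ipmx M M = \sum_i \sum_j a i j ^+ 2 * complex.Re (N i j * Num.conj (N i j)).
Proof.
move=> h; rewrite ipmxE; apply: eq_bigr => i _; apply: eq_bigr => j _.
rewrite h; case: (N i j) => p q /=; ring.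
Qed.

(** For positive definite [A] and [B] this is the squared Frobenius norm of
    [A^(-1/2) (A - B) B^(-1/2)]. *)
Definition mxgap A B : R :=
  retr (cinv A ** (A - B) ** cinv B ** cadj (A - B)).

(* In the eigenbases of [A] and [B] both sides become weighted sums with the
   common weights [|W i j|^2], [W = U ** cadj V], so that the inequality
   reduces to the scalar one. *)
Lemma ln_dist_le_gap A B : posdefmx A -> posdefmx B ->
  fnorm (mxfun (@ln R) A - mxfun (@ln R) B) ^+ 2 <= mxgap A B.
Proof.
move=> /posdefmxP[U [x [hU hx ->]]] /posdefmxP[V [y [hV hy ->]]].
rewrite !mxfun_udiagmx//.
pose W := U ** cadj V.
have key x' y' : U ** (udiagmx U x' - udiagmx V y') ** cadj V
    = diagRmx x' ** W - W ** diagRmx y'.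
  rewrite cmulBr cmulBl udiagmx.unlock /W !cmulA.
  by rewrite unitary_cmulV// cmul1m unitary_cmulK.
have entryE x' y' i j : (diagRmx x' ** W - W ** diagRmx y') i j =
    (x' 0 i - y' 0 j)%:C * W i j.
  rewrite mxE [X in _ + X]mxE mul_diagRmxE mul_mx_diagRmxE.
  by rewrite rmorphB mulrBl.
rewrite -(@fnorm_unitary _ _ U _ (cadj V)); last 2 first.
- exact: unitary_cVmul.
- by rewrite cadjK unitary_cVmul.
rewrite key fnorm_sqr.
rewrite (@ipmx_weighted (fun i j => ln (x 0 i) - ln (y 0 j)) _ W); last first.
  by move=> i j; rewrite entryE !mxE.
pose x' := map_mx (fun r => (Num.sqrt r)^-1) x.
pose y' := map_mx (fun r => (Num.sqrt r)^-1) y.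
have sq (z : 'rV[R]_d) : (forall j, 0 < z 0 j) ->
    diagRmx (map_mx GRing.inv z) = diagRmx (map_mx (fun r => (Num.sqrt r)^-1) z) **
    diagRmx (map_mx (fun r => (Num.sqrt r)^-1) z).
  move=> hz; rewrite diagRmxM; congr diagRmx; apply/rowP => j.
  by rewrite !mxE -expr2 exprVn sqr_sqrtr// ltW.
have x0 j : x 0 j != 0 by rewrite gt_eqF.
have y0 j : y 0 j != 0 by rewrite gt_eqF.
pose E := diagRmx x ** W - W ** diagRmx y.
have -> : mxgap (udiagmx U x) (udiagmx V y) =
  ipmx (diagRmx x' ** E ** diagRmx y') (diagRmx x' ** E ** diagRmx y').
  have -> : diagRmx x' ** E ** diagRmx y' =
      (diagRmx x' ** U) ** (udiagmx U x - udiagmx V y) ** (cadj V ** diagRmx y').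
    by rewrite /E -key !cmulA.
  rewrite ipmx_mul /mxgap !cadjM !cadj_diagRmx cadjK !cinv_udiagmx//.
  have uE V' (z : 'rV[R]_d) : (forall j, 0 < z 0 j) -> udiagmx V' (map_mx GRing.inv z) =
      cadj V' ** diagRmx (map_mx (fun r => (Num.sqrt r)^-1) z) **
      (diagRmx (map_mx (fun r => (Num.sqrt r)^-1) z) ** V').
    by move=> hz; rewrite udiagmx.unlock (sq z hz) !cmulA.
  by rewrite (uE U x hx) (uE V y hy) !cmulA.
rewrite (@ipmx_weighted (fun i j => (x 0 i - y 0 j) /
    (Num.sqrt (x 0 i) * Num.sqrt (y 0 j))) _ W); last first.
  move=> i j; rewrite mul_mx_diagRmxE mul_diagRmxE entryE !mxE.
  rewrite !mulrA -!rmorphM; congr (_%:C * _).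
  by rewrite invfM; ring.
apply: ler_sum => i _; apply: ler_sum => j _; apply: ler_wpM2r.
  by rewrite Re_mul_conj addr_ge0 ?sqr_ge0.
apply: (le_trans (sqr_lnB_le (hx i) (hy j))).
by rewrite expr_div_n exprMn !sqr_sqrtr// ltW.
Qed.

End SpectralCalculus.

(** * Real powers, and the behaviour of the gap under congruence *)

Section PowersAndCongruence.
Context {R : realType} {d : nat}.
Local Notation C := R[i].
Local Open Scope complex_scope.
Implicit Types (A B M N P Q U V X Z : 'M[C]_d) (x y : 'rV[R]_d) (f : R -> R).

Lemma mxgap_congr X A B : X \in unitmx -> A \in unitmx -> B \in unitmx ->
  mxgap (X ** A ** cadj X) (X ** B ** cadj X) = mxgap A B.
Proof.
move=> hX hA hB.
have hX' : cadj X \in unitmx by rewrite cadj_unit.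
have inv M : M \in unitmx ->
    cinv (X ** M ** cadj X) = cinv (cadj X) ** cinv M ** cinv X.
  move=> hM; have hXM : X ** M \in unitmx by rewrite cmul_unit hX hM.
  by rewrite (cinvM hXM hX') (cinvM hX hM) cmulA.
rewrite /mxgap (inv _ hA) (inv _ hB) -cmulBl -cmulBr !cadjM cadjK !cmulA.
by rewrite !(cmulmKV _ hX) !(cmulmK _ hX') retr_mulC !cmulA cmulmV// cmul1m.
Qed.

Lemma mxpow_udiagmx V x t : V \is unitarymx ->
  mxpow (udiagmx V x) t = udiagmx V (map_mx (fun r => r `^ t) x).
Proof. by move=> hV; rewrite mxpowE mxfun_udiagmx. Qed.

Lemma mxpowD A s t : posdefmx A -> mxpow A s ** mxpow A t = mxpow A (s + t).
Proof.
move=> /posdefmxP[V [x [hV hx ->]]]; rewrite !mxpow_udiagmx// udiagmxM//.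
congr udiagmx; apply/rowP => j; rewrite !mxE powRD//.
by apply/implyP => _; rewrite gt_eqF.
Qed.

Lemma mxpow1 A : posdefmx A -> mxpow A 1 = A.
Proof.
move=> /posdefmxP[V [x [hV hx ->]]]; rewrite mxpow_udiagmx//.
by congr udiagmx; apply/rowP => j; rewrite !mxE powRr1// ltW.
Qed.

Lemma mxpow0 A : posdefmx A -> mxpow A 0 = 1%:M.
Proof.
move=> /posdefmxP[V [x [hV hx ->]]]; rewrite mxpow_udiagmx//.
by rewrite -(udiagmx1 hV); congr udiagmx; apply/rowP => j; rewrite !mxE powRr0.
Qed.

Lemma mxpowN A t : posdefmx A -> cinv (mxpow A t) = mxpow A (- t).
Proof. by move=> pA; apply: cmul1_cinv; rewrite mxpowD// subrr mxpow0. Qed.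

Lemma posdefmx_mxpow A t : posdefmx A -> posdefmx (mxpow A t).
Proof.
move=> /posdefmxP[V [x [hV hx ->]]]; rewrite mxpow_udiagmx//.
by apply: posdefmx_udiagmx => // j; rewrite mxE powR_gt0.
Qed.

Lemma cadj_mxpow A t : posdefmx A -> cadj (mxpow A t) = mxpow A t.
Proof. by move=> /posdefmx_mxpow/posdefmx_cadj. Qed.

Lemma mxpow_unit A t : posdefmx A -> mxpow A t \in unitmx.
Proof. by move=> /posdefmx_mxpow/posdefmx_unit. Qed.

Lemma mxpow_half A : posdefmx A -> mxpow A 2^-1 ** mxpow A 2^-1 = A.
Proof.
have h : 2^-1 + 2^-1 = 1 :> R by lra.
by move=> pA; rewrite mxpowD// h mxpow1.
Qed.

Lemma mxpow_invE A : posdefmx A -> mxpow A (- 2^-1) ** mxpow A (- 2^-1) = cinv A.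
Proof.
have h : - 2^-1 + - 2^-1 = - 1 :> R by lra.
by move=> pA; rewrite mxpowD// h -mxpowN// mxpow1.
Qed.

Lemma mxfun_lnX A t : posdefmx A ->
  mxfun (@ln R) (mxpow A t) = t%:C *: mxfun (@ln R) A.
Proof.
move=> /posdefmxP[V [x [hV hx ->]]]; rewrite mxpow_udiagmx// !mxfun_udiagmx//.
rewrite udiagmx.unlock -cmulZl -cmulZr; congr (_ ** _ ** _).
apply/matrixP => i j; rewrite mxE !diagRmxE !mxE ln_powR rmorphM.
by case: eqP => _; rewrite ?mulr0n ?mulr0.
Qed.

Lemma mxfun_ln1 : mxfun (@ln R) (1%:M : 'M[C]_d) = 0.
Proof.
have := mxfun_lnX 0 posdefmx1; rewrite (mxpow0 posdefmx1) => ->.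
by rewrite rmorph0 scale0r.
Qed.

Lemma geodesicE A B t :
  geodesic A B t = mxpow A 2^-1 ** mxpow (mxpow A (- 2^-1) ** B ** mxpow A (- 2^-1)) t
                    ** mxpow A 2^-1.
Proof. by rewrite cmul.unlock. Qed.

(** The squared Riemannian norm of the tangent vector [M] at [A]. Being written with inverses only,
    it varies continuously without any appeal to continuity of the matrix square root. *)
Definition mxspeed A M : R := retr (cinv A ** M ** cinv A ** cadj M).

Lemma fnorm_speed A M : posdefmx A ->
  fnorm (mxpow A (- 2^-1) ** M ** mxpow A (- 2^-1)) = Num.sqrt (mxspeed A M).
Proof.
by move=> pA; rewrite fnormE ipmx_mul cadj_mxpow// mxpow_invE.
Qed.

End PowersAndCongruence.

(** * Matrix limits, expressed through real limits of [fnorm] *)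

Lemma cvg_sumr (R : realType) (T : Type) (F : set_system T) (FF : Filter F)
    (I : Type) (r : seq I) (f : I -> T -> R) (l : I -> R) :
  (forall i, f i x @[x --> F] --> l i) ->
  \sum_(i <- r) f i x @[x --> F] --> \sum_(i <- r) l i.
Proof.
move=> h; elim: r => [|i r IH].
  by under eq_fun do rewrite big_nil; rewrite big_nil; exact: cvg_cst.
by under eq_fun do rewrite big_cons; rewrite big_cons; exact: cvgD.
Qed.

Section FrobeniusLimits.
Context {R : realType} {d : nat}.
Local Notation C := R[i].
Local Open Scope complex_scope.
Implicit Types (A B M N : 'M[C]_d).

Lemma normc_le_ReIm (z : C) :
  ComplexField.Normc.normc z <= `|complex.Re z| + `|complex.Im z|.
Proof.
rewrite -(@ler_pXn2r _ 2)// ?nnegrE ?addr_ge0//; last first.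
  by case: z => a b /=; exact: sqrtr_ge0.
rewrite normc_sqr sqrrD !real_normK ?num_real// lerD2r lerDl.
by rewrite mulrn_wge0// mulr_ge0.
Qed.

Lemma fnorm_le_sum M :
  fnorm M <= \sum_i \sum_j ComplexField.Normc.normc (M i j).
Proof.
have nc0 (z : C) : 0 <= ComplexField.Normc.normc z.
  by case: z => a b /=; exact: sqrtr_ge0.
have sq (I : finType) (F : I -> R) : (forall i, 0 <= F i) ->
    \sum_i F i ^+ 2 <= (\sum_i F i) ^+ 2.
  move=> F0; rewrite [leRHS]expr2 mulr_suml; apply: ler_sum => i _.
  rewrite expr2 ler_wpM2l// (bigD1 i)//= lerDl; exact: sumr_ge0.
have S0 i : 0 <= \sum_j ComplexField.Normc.normc (M i j) by exact: sumr_ge0.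
rewrite -(@ler_pXn2r _ 2)// ?nnegrE ?fnorm_ge0 ?sumr_ge0//.
rewrite fnorm_sqr ipmxE; apply: le_trans (sq _ _ S0).
apply: ler_sum => i _; apply: le_trans (sq _ _ _); last by move=> j.
by apply: ler_sum => j _; rewrite Re_mul_conj normc_sqr.
Qed.

(** A crude constant, enough for limits: the norm is at most the sum of the moduli of [d ^ 2]
    entries, each a sum of [d] products. *)
Lemma fnorm_mul_le M N : fnorm (M ** N) <= d%:R ^+ 3 * (fnorm M * fnorm N).
Proof.
apply: (le_trans (fnorm_le_sum _)).
have -> : d%:R ^+ 3 * (fnorm M * fnorm N) =
    \sum_(i < d) \sum_(j < d) \sum_(k < d) (fnorm M * fnorm N).
  by rewrite !sumr_const card_ord -!mulrnA -[RHS]mulr_natl !natrM; ring.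
apply: ler_sum => i _; apply: ler_sum => j _; rewrite cmulE.
apply: (@le_trans _ _ (\sum_k ComplexField.Normc.normc (M i k * N k j))).
  elim/big_rec2: _ => [|k x y _ h]; first by rewrite ComplexField.Normc.normc0.
  apply: (@le_trans _ _ (ComplexField.Normc.normc (M i k * N k j) +
    ComplexField.Normc.normc y)); last by rewrite lerD2l.
  by rewrite -lecR rmorphD/=; exact: (@ler_normD _ C).
apply: ler_sum => k _; rewrite ComplexField.Normc.normcM.
have nc0 (z : C) : 0 <= ComplexField.Normc.normc z.
  by case: z => a b /=; exact: sqrtr_ge0.
by apply: ler_pM => //; exact: normc_le_fnorm.
Qed.

Lemma fnorm_cadj M : fnorm (cadj M) = fnorm M.
Proof.
by rewrite !fnormE !ipmx_retr cadjK retr_mulC.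
Qed.

Lemma ler_retr_fnorm M : `|retr M| <= fnorm M * fnorm (1%:M : 'M[C]_d).
Proof.
have -> : retr M = ipmx M 1%:M by rewrite ipmx_retr cadj1 cmulm1.
by rewrite ler_norml lerNl -ipmxNl -{1}(fnormN M) !ipmx_le_fnorm.
Qed.

Lemma retrB M N : retr (M - N) = retr M - retr N.
Proof. by apply/eqP; rewrite eq_sym subr_eq -retrD subrK. Qed.

Section Filter.
Context {T : Type} {F : set_system T} {FF : Filter F}.
Implicit Types f g : T -> 'M[C]_d.

Lemma fnorm_cvg_cst M : fnorm (M - M) @[x --> F] --> 0.
Proof. by rewrite subrr fnorm0; exact: cvg_cst. Qed.

(** The bridge from derivatives of curves, which are given by real and imaginary parts of entries,
    to limits in [fnorm]. *)
Lemma fnorm_cvg_entries f M :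
  (forall i j, complex.Re (f x i j) @[x --> F] --> complex.Re (M i j)) ->
  (forall i j, complex.Im (f x i j) @[x --> F] --> complex.Im (M i j)) ->
  fnorm (f x - M) @[x --> F] --> 0.
Proof.
move=> hR hI.
apply: (@squeeze_cvgr _ _ _ _ (fun=> 0) (fun x => \sum_i \sum_j
   (`|complex.Re (f x i j) - complex.Re (M i j)| +
    `|complex.Im (f x i j) - complex.Im (M i j)|))).
- apply: nearW => x; rewrite fnorm_ge0/=.
  apply: (le_trans (fnorm_le_sum _)); apply: ler_sum => i _; apply: ler_sum => j _.
  apply: (le_trans (normc_le_ReIm _)); rewrite !mxE.
  by case: (f x i j) (M i j) => a b [c e].
- exact: cvg_cst.
have E0 : \sum_(i < d) \sum_(j < d) (`|0 : R| + `|0 : R|) = 0 :> R.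
  by rewrite normr0 addr0 big1// => i _; rewrite big1.
rewrite -[X in _ --> X]E0.
apply: (@cvg_sumr R T F FF 'I_d _ (fun i x => \sum_j
   (`|complex.Re (f x i j) - complex.Re (M i j)| +
    `|complex.Im (f x i j) - complex.Im (M i j)|))) => i.
apply: (@cvg_sumr R T F FF 'I_d _ (fun j x =>
   (`|complex.Re (f x i j) - complex.Re (M i j)| +
    `|complex.Im (f x i j) - complex.Im (M i j)|))) => j.
apply: cvgD; apply: cvg_norm.
  by rewrite -(subrr (complex.Re (M i j))); apply: cvgB (hR i j) _; exact: cvg_cst.
by rewrite -(subrr (complex.Im (M i j))); apply: cvgB (hI i j) _; exact: cvg_cst.
Qed.

Lemma fnorm_cvgM f g M N : fnorm (f x - M) @[x --> F] --> 0 ->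
  fnorm (g x - N) @[x --> F] --> 0 -> fnorm (f x ** g x - M ** N) @[x --> F] --> 0.
Proof.
move=> hf hg.
apply: (@squeeze_cvgr _ _ _ _ (fun=> 0) (fun x => d%:R ^+ 3 *
  (fnorm (f x - M) * fnorm (g x - N) + fnorm (f x - M) * fnorm N +
   fnorm M * fnorm (g x - N)))).
- apply: nearW => x; rewrite fnorm_ge0/=.
  have -> : f x ** g x - M ** N =
      (f x - M) ** (g x - N) + (f x - M) ** N + M ** (g x - N).
    rewrite !(cmulBl, cmulBr).
    move: (f x ** g x) (f x ** N) (M ** g x) (M ** N) => a b c e.
    by apply/matrixP => i j; rewrite !mxE; ring.
  rewrite !mulrDr; apply: (le_trans (ler_fnormD _ _)); apply: lerD.
    by apply: (le_trans (ler_fnormD _ _)); apply: lerD; exact: fnorm_mul_le.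
  exact: fnorm_mul_le.
- exact: cvg_cst.
have -> : 0 = d%:R ^+ 3 * (0 * 0 + 0 * fnorm N + fnorm M * 0) :> R by ring.
apply: cvgM; first exact: cvg_cst.
apply: cvgD; [apply: cvgD|]; apply: cvgM => //; exact: cvg_cst.
Qed.

Lemma fnorm_cvg_cadj f M : fnorm (f x - M) @[x --> F] --> 0 ->
  fnorm (cadj (f x) - cadj M) @[x --> F] --> 0.
Proof. by under [in X in _ -> X]eq_fun do rewrite -cadjB fnorm_cadj. Qed.

Lemma fnorm_cvg_retr f M : fnorm (f x - M) @[x --> F] --> 0 ->
  retr (f x) @[x --> F] --> retr M.
Proof.
move=> hf; apply/cvgrPdistC_le => e e0.
have e'0 : 0 < e / (fnorm (1%:M : 'M[C]_d) + 1).
  by rewrite divr_gt0// ltr_wpDl// fnorm_ge0.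
move/cvgr0_norm_le : hf => /(_ _ e'0); apply: filterS => x.
rewrite ger0_norm ?fnorm_ge0// ler_pdivlMr ?ltr_wpDl ?fnorm_ge0// => h.
rewrite -retrB; apply: (le_trans (ler_retr_fnorm _)); apply: le_trans h.
by rewrite ler_wpM2l ?fnorm_ge0// lerDl.
Qed.

(* Resolvent identity: [B^-1 - A^-1 = A^-1 (A - B) B^-1]. *)
Lemma fnorm_cvg_cinv f M : (\forall x \near F, f x \in unitmx) -> M \in unitmx ->
  fnorm (f x - M) @[x --> F] --> 0 ->
  fnorm (cinv (f x) - cinv M) @[x --> F] --> 0.
Proof.
move=> uf uM hf.
pose K : R := d%:R ^+ 3 * fnorm (cinv M) * d%:R ^+ 3.
have K0 : 0 <= K by rewrite !mulr_ge0// ?fnorm_ge0// exprn_ge0.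
have resolv : \forall x \near F,
    fnorm (cinv (f x) - cinv M) <= K * fnorm (f x - M) * fnorm (cinv (f x)).
  move: uf; apply: filterS => x ux.
  have -> : cinv (f x) - cinv M = cinv M ** ((M - f x) ** cinv (f x)).
    by rewrite cmulBl (cmulmV ux) cmulBr cmulm1 cmulA (cmulVm uM) cmul1m.
  apply: (le_trans (fnorm_mul_le _ _)); rewrite /K (fnormB (f x)).
  have := fnorm_mul_le (M - f x) (cinv (f x)).
  have : 0 <= d%:R ^+ 3 :> R by rewrite exprn_ge0.
  move: (d%:R ^+ 3) (fnorm_ge0 (cinv M)) => c m0 c0 h.
  have -> (a b e : R) : c * a * c * b * e = c * (a * (c * (b * e))) by ring.
  by rewrite ler_wpM2l// ler_wpM2l.
(* The bound [resolv] contains [fnorm (cinv (f x))] itself. Once its coefficient is at most [2^-1],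
   the triangle inequality absorbs that term in the left side. *)
have bnd : \forall x \near F, fnorm (cinv (f x)) <= 2 * fnorm (cinv M).
  have e0 : 0 < (2 * (K + 1))^-1 by rewrite invr_gt0 mulr_gt0// ltr_wpDl.
  move/cvgr0_norm_le : hf => /(_ _ e0) hf.
  move: resolv hf; apply: filterS2 => x h1 h2.
  rewrite ger0_norm ?fnorm_ge0// in h2.
  have h3 : K * fnorm (f x - M) <= 2^-1.
    have : K * fnorm (f x - M) <= K * (2 * (K + 1))^-1 by exact: ler_wpM2l.
    move/le_trans; apply; rewrite invfM mulrCA ler_piMr//.
    by rewrite ler_pdivrMr ?ltr_wpDl// mul1r lerDl.
  have h4 := ler_fnormD (cinv (f x) - cinv M) (cinv M); rewrite subrK in h4.
  have h5 := fnorm_ge0 (cinv (f x)); nra.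
apply: (@squeeze_cvgr _ _ _ _ (fun=> 0)
  (fun x => K * fnorm (f x - M) * (2 * fnorm (cinv M)))).
- move: resolv bnd; apply: filterS2 => x h1 h2; rewrite fnorm_ge0/=.
  by apply: (le_trans h1); rewrite ler_wpM2l// mulr_ge0// fnorm_ge0.
- exact: cvg_cst.
have -> : 0 = K * 0 * (2 * fnorm (cinv M)) by ring.
by apply: cvgM; [apply: cvgM => //|]; exact: cvg_cst.
Qed.

End Filter.

End FrobeniusLimits.

Lemma derivable_cvg_quotient (R : realType) (f : R -> R) (t : R) : derivable f t 1 ->
  h^-1 * (f (h + t) - f t) @[h --> 0^'] --> derive1 f t.
Proof.
move=> df; rewrite derive1E.
have : h^-1 *: ((f \o shift t) (h *: 1) - f t) @[h --> 0^'] --> 'D_1 f t by exact: df.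
by under eq_fun do rewrite /= /GRing.scale /= mulr1.
Qed.

(** * Speed and gap along a smooth curve *)

Section SmoothCurves.
Context {R : realType} {d : nat}.
Local Notation C := R[i].
Local Open Scope complex_scope.
Implicit Types (A B M N : 'M[C]_d) (beta : R -> 'M[C]_d) (I : set R).

Lemma smooth_curve_cvg beta t : smooth_curve beta ->
  fnorm (beta s - beta t) @[s --> t] --> 0.
Proof.
move=> hb; apply: fnorm_cvg_entries => i j; have [hR hI] := hb i j.
  have /derivable1_diffP/differentiable_continuous := hR 0%N t; exact.
have /derivable1_diffP/differentiable_continuous := hI 0%N t; exact.
Qed.

Lemma mxderiv_cvg beta t : smooth_curve beta ->
  fnorm (mxderiv beta s - mxderiv beta t) @[s --> t] --> 0.
Proof.
move=> hb; apply: fnorm_cvg_entries => i j; have [hR hI] := hb i j.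
  under eq_fun do rewrite mxE /=; rewrite mxE /=.
  have /derivable1_diffP/differentiable_continuous := hR 1%N t; exact.
under eq_fun do rewrite mxE /=; rewrite mxE /=.
have /derivable1_diffP/differentiable_continuous := hI 1%N t; exact.
Qed.

Lemma mxderiv_quotient_cvg beta t : smooth_curve beta ->
  fnorm ((h^-1)%:C *: (beta (h + t) - beta t) - mxderiv beta t) @[h --> 0^'] --> 0.
Proof.
have ReImZ (a : R) (z w : C) : (complex.Re (a%:C * (z - w)) = a * (complex.Re z - complex.Re w))
    /\ (complex.Im (a%:C * (z - w)) = a * (complex.Im z - complex.Im w)).
  by case: z w => z1 z2 [w1 w2] /=; rewrite !mul0r subr0 addr0.
move=> hb; apply: fnorm_cvg_entries => i j; have [hR hI] := hb i j.
  under eq_fun do rewrite !mxE (ReImZ _ _ _).1; rewrite mxE /=.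
  exact: (derivable_cvg_quotient (hR 0%N t)).
under eq_fun do rewrite !mxE (ReImZ _ _ _).2; rewrite mxE /=.
exact: (derivable_cvg_quotient (hI 0%N t)).
Qed.

Lemma retrZ (a : R) M : retr (a%:C *: M) = a * retr M.
Proof.
rewrite retr.unlock mxtraceZ; case: (\tr _) => x y /=.
by rewrite mul0r subr0.
Qed.

(** Continuity is relative to [I], because outside a piece of a path the smooth extension [beta] may
    leave the invertible matrices. *)
Lemma mxspeed_within_continuous beta I : smooth_curve beta ->
  (forall t, I t -> posdefmx (beta t)) ->
  {within I, continuous (fun t => Num.sqrt (mxspeed (beta t) (mxderiv beta t)))}.
Proof.
move=> hb pI; apply/subspace_continuousP => t It.
apply: (@continuous_cvg _ _ _ _ _ (fun s => mxspeed (beta s) (mxderiv beta s)) Num.sqrt).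
  exact: sqrt_continuous.
apply: fnorm_cvg_retr.
have bt : fnorm (beta s - beta t) @[s --> within I (nbhs t)] --> 0.
  by apply: cvg_within_filter; exact: smooth_curve_cvg.
have dt : fnorm (mxderiv beta s - mxderiv beta t) @[s --> within I (nbhs t)] --> 0.
  by apply: cvg_within_filter; exact: mxderiv_cvg.
have it : fnorm (cinv (beta s) - cinv (beta t)) @[s --> within I (nbhs t)] --> 0.
  apply: fnorm_cvg_cinv => //; last exact/posdefmx_unit/pI.
  by apply: filterS (withinT I _) => s /pI/posdefmx_unit.
by do ?[apply: fnorm_cvgM => //]; apply: fnorm_cvg_cadj.
Qed.

(* With [Q h = h^-1 (beta (t + h) - beta t)], the gap between [beta (t + h)] and
   [beta t] is [h^2 retr (beta (t + h)^-1 Q (beta t)^-1 (cadj Q))], whose trace tends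
   to the squared speed. *)
Lemma gap_le_speed_near beta I t (e : R) : smooth_curve beta ->
  (forall s, I s -> posdefmx (beta s)) -> I t -> 0 < e ->
  \forall s \near t, I s -> Num.sqrt (mxgap (beta s) (beta t)) <=
    (Num.sqrt (mxspeed (beta t) (mxderiv beta t)) + e) * `|s - t|.
Proof.
move=> hb pI It e0.
pose Q h := (h^-1)%:C *: (beta (h + t) - beta t).
(* This filter keeps [h] nonzero, for the quotient, and [h + t] in [I], for the inverse. *)
pose G := within [set h | I (h + t)] (0 : R)^'.
have FG : Filter G by exact: within_filter.
have Qt : fnorm (Q h - mxderiv beta t) @[h --> G] --> 0.
  by apply: cvg_within_filter; exact: mxderiv_quotient_cvg.
have bt : fnorm (beta (h + t) - beta t) @[h --> G] --> 0.
  apply: cvg_within_filter.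
  apply: (@cvg_comp _ _ _ (fun h : R => h + t) (fun s => fnorm (beta s - beta t))
    _ (nbhs t)); last exact: smooth_curve_cvg.
  have : h + t @[h --> (0 : R)] --> 0 + t.
    by apply: cvgD; [exact: cvg_id|exact: cvg_cst].
  by rewrite add0r; exact: cvg_within_filter.
have it : fnorm (cinv (beta (h + t)) - cinv (beta t)) @[h --> G] --> 0.
  apply: fnorm_cvg_cinv => //; last exact/posdefmx_unit/pI.
  by apply: filterS (withinT _ _) => s /pI/posdefmx_unit.
pose q h := retr (cinv (beta (h + t)) ** Q h ** cinv (beta t) ** cadj (Q h)).
have qt : Num.sqrt (q h) @[h --> G] --> Num.sqrt (mxspeed (beta t) (mxderiv beta t)).
  apply: (@continuous_cvg _ _ _ _ _ q Num.sqrt); first exact: sqrt_continuous.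
  apply: fnorm_cvg_retr; apply: fnorm_cvgM; last exact: fnorm_cvg_cadj.
  by apply: fnorm_cvgM; [exact: fnorm_cvgM|exact: fnorm_cvg_cst].
set v := Num.sqrt (mxspeed _ _) in qt *.
have v0 : 0 <= v by rewrite sqrtr_ge0.
have /cvgrPdist_le/(_ _ e0) := qt.
rewrite /G => -[r /= r0 hr].
exists r => //= s; rewrite /ball/= => st Is.
(* The limit is taken along nonzero increments; at [s = t] the gap vanishes. *)
have [<-|st0] := eqVneq t s.
  rewrite subrr normr0 mulr0 /mxgap subrr.
  by rewrite -(scale0r (0 : 'M[C]_d)) -(rmorph0 (real_complex R)) !(cmulZl, cmulZr) retrZ mul0r sqrtr0.
have [h hE] : exists h, h = s - t by exists (s - t).
have sE : s = h + t by rewrite hE subrK.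
have h0 : h != 0 by rewrite hE subr_eq0 eq_sym.
have := hr h _ h0; rewrite /= -sE => /(_ _ Is).
rewrite /ball/= sub0r normrN hE distrC => /(_ st); rewrite -hE => hq.
have -> : mxgap (beta s) (beta t) = h ^+ 2 * q h.
  have bE : beta s - beta t = h%:C *: Q h.
    by rewrite /Q -sE scalerA -rmorphM mulfV// rmorph1 scale1r.
  rewrite /mxgap bE /q -sE cadjZ !(cmulZl, cmulZr) scalerA -rmorphM retrZ.
  by rewrite expr2.
rewrite sqrtrM ?sqr_ge0// sqrtr_sqr mulrC (distrC t) -hE ler_wpM2r//.
by move: hq; rewrite ler_norml => /andP[]; rewrite lerBlDr; lra.
Qed.

End SmoothCurves.

(* Take the supremum [c] of the [x] with [P u x]: locality at [c] carries [P u]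
   past [c] unless [c = w]. *)
Lemma cousin_additive (R : realType) (P : R -> R -> Prop) (u w : R) : u <= w ->
  (forall x y z, u <= x -> x <= y -> y <= z -> z <= w -> P x y -> P y z -> P x z) ->
  (forall t, u <= t -> t <= w -> exists2 e, 0 < e &
    forall x y, u <= x -> x <= t -> t <= y -> y <= w -> t - e < x -> y < t + e -> P x y) ->
  P u w.
Proof.
move=> uw addP locP.
pose E := [set x | [/\ u <= x, x <= w & P u x]].
have Eu : E u.
  split => //; have [e e0 h] := locP u (lexx u) uw.
  by apply: h; rewrite ?lexx// ?ltrBlDr ltrDl.
have supE : has_sup E by split; [exists u | exists w => x []].
set c := sup E.
have uc : u <= c by exact: (sup_upper_bound supE).
have cw : c <= w by apply: ge_sup; [exists u | move=> x []].
have [e e0 h] := locP c uc cw.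
have [x [ux xw Px] cx] := sup_adherent e0 supE.
have xc : x <= c by apply: sup_upper_bound => //; split.
have step y : c <= y -> y <= w -> y < c + e -> E y.
  move=> cy yw yc; split => //; first exact: le_trans cy.
  apply: (addP _ x) => //; first exact: le_trans xc cy.
  exact: h.
have [wc|cw'] := leP w c.
  have -> : w = c by apply/eqP; rewrite eq_le wc cw.
  by have [] := step c (lexx _) cw; rewrite ?ltrDl.
pose y := Num.min w (c + e / 2).
have cy : c < y by rewrite lt_min cw' ltrDl divr_gt0.
have : y <= c.
  apply: sup_upper_bound => //; apply: step; first exact: ltW.
    by rewrite ge_min lexx.
  by rewrite gt_min ltrD2l; apply/orP; right; lra.
by rewrite leNgt cy.
Qed.

(** * From a local speed bound to an integral bound *)

Section IntegralBound.
Context {R : realType}.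
Local Notation mu := (@lebesgue_measure R).

Lemma Rintegral_itv_add (f : R -> R) (x y z : R) : x <= y -> y <= z ->
  mu.-integrable `[x, z] (EFin \o f) ->
  \int[mu]_(t in `[x, z]) f t = \int[mu]_(t in `[x, y]) f t + \int[mu]_(t in `[y, z]) f t.
Proof.
move=> xy yz fi.
have h1 := @Rintegral_itvB R f (BLeft x) (BRight z) y fi.
rewrite !bnd_simp in h1; have := h1 xy yz.
rewrite Rintegral_itv_obnd_cbnd; last first.
  apply: integrableS fi => //; apply: subset_itv; rewrite ?bnd_simp//.
by move=> <-; rewrite addrC subrK.
Qed.

(* The hypotheses on [D] say that [D] is a pseudometric along a curve whose
   metric speed at [t] is at most [v t]. *)
Lemma dist_le_Rintegral_speed (D : R -> R -> R) (v : R -> R) (u w : R) : u <= w ->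
  (forall x y z, D x z <= D x y + D y z) -> (forall x y, D x y = D y x) ->
  {within `[u, w], continuous v} ->
  (forall t e : R, t \in `[u, w] -> 0 < e -> \forall s \near t, s \in `[u, w] ->
     D s t <= (v t + e) * `|s - t|) ->
  D u w <= \int[mu]_(t in `[u, w]) v t.
Proof.
move=> uw Dtri Dsym cv loc.
have vint : mu.-integrable `[u, w] (EFin \o v).
  by apply: continuous_compact_integrable => //; exact: segment_compact.
have vintS x y : u <= x -> y <= w -> mu.-integrable `[x, y] (EFin \o v).
  move=> ux yw; apply: integrableS vint => //.
  by apply: subset_itv; rewrite bnd_simp.
apply/ler_addgt0Pr => e0 e0_gt0.
(* Chosen so that the total error [2 * e * (w - u)] is at most [e0]; the summand 1 covers
   [u = w]. *)
pose e := e0 / (2 * (w - u + 1)).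
have wu1 : 0 < w - u + 1 by rewrite ltr_wpDl// subr_ge0.
have e_gt0 : 0 < e by rewrite divr_gt0// mulr_gt0.
suff : D u w <= \int[mu]_(t in `[u, w]) v t + 2 * e * (w - u).
  move/le_trans; apply; rewrite lerD2l.
  have -> : e0 = 2 * e * (w - u + 1) by rewrite /e; field; rewrite gt_eqF.
  by apply: ler_wpM2l; [rewrite mulr_ge0 ?ltW|rewrite lerDl].
(* Each short interval loses [e] times its length twice: in the bound for [D], and in replacing
   [v t] by the integral of [v]. The claim with this error is additive in intervals. *)
apply: (@cousin_additive R (fun x y =>
  D x y <= \int[mu]_(t in `[x, y]) v t + 2 * e * (y - x)) u w uw).
  move=> x y z ux xy yz zw h1 h2; apply: (le_trans (Dtri x y z)).
  rewrite (@Rintegral_itv_add v x y z) ?vintS//.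
  by apply: (le_trans (lerD h1 h2)); lra.
move=> t ut tw.
have tI : t \in `[u, w] by rewrite in_itv /= ut tw.
have /subspace_continuousP/(_ t) := cv; rewrite /= in_itv /= ut tw => /(_ isT).
move/cvgrPdist_le => /(_ _ e_gt0); rewrite /prop_near1 /within /= => -[r1 /= r10 hv].
have [r2 /= r20 hD] := loc t e tI e_gt0.
exists (Num.min r1 r2); first by rewrite lt_min r10.
move=> x y ux xt ty yw xr yr.
have near_t s : x <= s -> s <= y -> `|t - s| < r1 /\ `|t - s| < r2.
  move=> xs sy; apply/andP; rewrite -lt_min ltr_norml.
  by move: (Num.min r1 r2) xr yr => r xr yr; apply/andP; split; lra.
have Ds s : x <= s -> s <= y -> D s t <= (v t + e) * `|s - t|.
  move=> xs sy; apply: hD; first exact: (near_t s xs sy).2.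
  by rewrite in_itv /= (le_trans ux xs) (le_trans sy yw).
have xy := le_trans xt ty.
have h1 := Ds x (lexx x) xy; have h2 := Ds y xy (lexx y).
rewrite ler0_norm ?subr_le0// in h1; rewrite ger0_norm ?subr_ge0// in h2.
have h3 : (v t - e) * (y - x) <= \int[mu]_(s in `[x, y]) v s.
  have <- : \int[mu]_(s in `[x, y]) (v t - e) = (v t - e) * (y - x).
    rewrite Rintegral_cst//= lebesgue_measure_itv /= lte_fin.
    case: ltP => // yx; have -> : y = x by apply/eqP; rewrite eq_le yx xy.
    by rewrite subrr.
  apply: le_Rintegral => //; last 1 first.
  - move=> s; rewrite /= in_itv /= => /andP[xs sy].
    have sI : s \in `[u, w] by rewrite in_itv /= (le_trans ux xs) (le_trans sy yw).
    have : `|v t - v s| <= e := hv s (near_t s xs sy).1 sI.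
    by rewrite ler_norml => /andP[]; lra.
  - apply: continuous_compact_integrable; first exact: segment_compact.
    by apply: continuous_subspaceT => s; exact: cst_continuous.
  - exact: vintS.
have := Dtri x t y; rewrite (Dsym t y); lra.
Qed.

End IntegralBound.

Lemma integrable_setU (d : measure_display) (T : measurableType d) (R : realType)
    (mu : {measure set T -> \bar R}) (A B : set T) (f : T -> \bar R) :
  measurable A -> measurable B -> [disjoint A & B] ->
  mu.-integrable A f -> mu.-integrable B f -> mu.-integrable (A `|` B) f.
Proof.
move=> mA mB AB /integrableP[mfA fA] /integrableP[mfB fB].
have mf : measurable_fun (A `|` B) f by apply/measurable_funU.
apply/integrableP; split => //; rewrite ge0_integral_setU//.
  exact: lte_add_pinfty.
exact: measurableT_comp.
Qed.

(** * Logarithmic charts do not increase the length of paths *)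

Section PathLength.
Context {R : realType} {d : nat}.
Local Notation mu := (@lebesgue_measure R).
Local Notation C := R[i].
Local Open Scope complex_scope.
Implicit Types (A B M N X : 'M[C]_d) (alpha beta : R -> 'M[C]_d).

(** Endpoints are null. At a breakpoint the derivative of a path need not be that of the smooth
    piece, so the two speeds are compared on the open interval only. *)
Lemma integrable_eq_open (f g : R -> R) (x y : R) :
  {in `]x, y[, f =1 g} -> mu.-integrable `[x, y] (EFin \o g) ->
  mu.-integrable `[x, y] (EFin \o f) /\
  \int[mu]_(t in `[x, y]) f t = \int[mu]_(t in `[x, y]) g t.
Proof.
move=> fg gi.
have gi' : mu.-integrable `]x, y[ (EFin \o g).
  by apply: integrableS gi => //; apply: subset_itv; rewrite bnd_simp.
have fi' : mu.-integrable `]x, y[ (EFin \o f).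
  by apply: eq_integrable gi' => // t; rewrite inE /= => /fg ->.
have mf := measurable_int _ fi'; have mg := measurable_int _ gi'.
split; last first.
  rewrite /Rintegral (@integral_itv_bndoo R x y _ true false mf).
  rewrite (@integral_itv_bndoo R x y _ true false mg).
  by congr fine; apply: eq_integral => t; rewrite inE /= => /fg ->.
apply/integrableP; split; first exact: emeasurable_fun_itv_cc mf.
rewrite (@integral_itv_bndoo R x y _ true false); last exact: measurableT_comp.
by move/integrableP: fi' => [].
Qed.

Definition path_speed alpha t : R :=
  frobenius_norm
    (mxpow (alpha t) (- 2^-1) *m mxderiv alpha t *m mxpow (alpha t) (- 2^-1)).

Lemma path_speedE alpha t : posdefmx (alpha t) ->
  path_speed alpha t = Num.sqrt (mxspeed (alpha t) (mxderiv alpha t)).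
Proof. by move=> pt; rewrite -fnorm_speed// fnorm.unlock cmul.unlock. Qed.

Lemma eq_mxderiv alpha beta (x y t : R) : {in `[x, y], alpha =1 beta} ->
  t \in `]x, y[ -> mxderiv alpha t = mxderiv beta t.
Proof.
move=> ab txy; apply/matrixP => i j; rewrite !mxE.
have nab : \forall s \near t, alpha s = beta s.
  have := near_in_itvoo txy; apply: filterS => s sxy.
  by apply: ab; move: sxy; rewrite !in_itv /= => /andP[/ltW -> /ltW ->].
congr (_ +i* _).
  by rewrite !derive1E; apply: near_eq_derive; apply: filterS nab => s ->.
by rewrite !derive1E; apply: near_eq_derive; apply: filterS nab => s ->.
Qed.

Definition log_dist X A B : R :=
  fnorm (mxfun (@ln R) (X ** A ** cadj X) - mxfun (@ln R) (X ** B ** cadj X)).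

Lemma log_dist_triangle X B A M : log_dist X A M <= log_dist X A B + log_dist X B M.
Proof. exact: ler_fnorm_dist. Qed.

Lemma log_distC X A B : log_dist X A B = log_dist X B A.
Proof. exact: fnormB. Qed.

(** The gap does not see the congruence by [X], so a single estimate serves all charts. *)
Lemma log_dist_le_gap X A B : X \in unitmx -> posdefmx A -> posdefmx B ->
  log_dist X A B <= Num.sqrt (mxgap A B).
Proof.
move=> hX pA pB.
rewrite -(@mxgap_congr _ _ X)//; try exact: posdefmx_unit.
rewrite -[leLHS]ger0_norm ?fnorm_ge0// -sqrtr_sqr ler_wsqrtr//.
by apply: ln_dist_le_gap; exact: posdefmx_congr.
Qed.

(** Chart distance along the piece is a pseudometric whose local growth is controlled by the gap,
    hence by the speed; integrating this bound never differentiates the chart. *)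
Lemma log_dist_le_piece X alpha beta (x y : R) : X \in unitmx -> x <= y ->
  smooth_curve beta -> {in `[x, y], alpha =1 beta} ->
  {in `[x, y], forall t, posdefmx (alpha t)} ->
  mu.-integrable `[x, y] (EFin \o path_speed alpha) /\
  log_dist X (alpha x) (alpha y) <= \int[mu]_(t in `[x, y]) path_speed alpha t.
Proof.
move=> hX xy sb ab pa.
have pb t : t \in `[x, y] -> posdefmx (beta t) by move=> h; rewrite -ab//; exact: pa.
pose v t := Num.sqrt (mxspeed (beta t) (mxderiv beta t)).
have cv : {within `[x, y], continuous v} by exact: mxspeed_within_continuous.
have vi : mu.-integrable `[x, y] (EFin \o v).
  by apply: continuous_compact_integrable => //; exact: segment_compact.
have sv : {in `]x, y[, path_speed alpha =1 v}.
  move=> t txy; have txy' : t \in `[x, y] by exact: subset_itv_oo_cc txy.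
  rewrite path_speedE; last exact: pa.
  by rewrite /v (eq_mxderiv ab txy) ab.
have [fi ->] := integrable_eq_open sv vi; split => //.
rewrite !ab ?in_itv /= ?lexx ?xy//.
apply: (@dist_le_Rintegral_speed R (fun s t => log_dist X (beta s) (beta t))) => //.
- by move=> r s t; exact: log_dist_triangle.
- by move=> r s; exact: log_distC.
move=> t e tI e0.
have := @gap_le_speed_near _ _ beta [set` `[x, y]] t e sb pb tI e0.
apply: filterS => s h sI; apply: le_trans (h sI).
by apply: log_dist_le_gap => //; exact: pb.
Qed.

Lemma log_dist_le_length X A B a b alpha : X \in unitmx -> pd_path A B a b alpha ->
  log_dist X A B <= path_length a b alpha.
Proof.
move=> hX [_ [s ps hs] pa <- <-]; rewrite /path_length -/(path_speed alpha).
(* Integrability is carried through the induction on the partition, since splitting the integral at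
   a breakpoint presupposes it. *)
suff [] : mu.-integrable `[a, b] (EFin \o path_speed alpha) /\
  log_dist X (alpha a) (alpha b) <= \int[mu]_(t in `[a, b]) path_speed alpha t by [].
elim: s a ps hs pa => [|x s IH] a ps hs pa.
  have -> : b = a by have := itv_partition_nil ps.
  have z : mu.-integrable `[a, a] (EFin \o cst (0 : R)) by exact: integrable0.
  have oo : {in `]a, a[, path_speed alpha =1 cst 0} by move=> t; rewrite in_itv /= lt_asym.
  have [-> _] := integrable_eq_open oo z; split => //.
  rewrite /log_dist subrr fnorm0; apply: Rintegral_ge0 => t _.
  exact: sqrtr_ge0.
have ax : a <= x by have [/= /andP[/ltW]] := ps.
have xb : x <= b by exact: itv_partition_le (itv_partition_cons ps).
have [beta sb ab] := hs 0%N isT.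
have [|i1 d1] := log_dist_le_piece hX ax sb ab.
  by move=> t; rewrite in_itv /= => /andP[h1 h2]; apply: pa; rewrite in_itv /= h1 (le_trans h2 xb).
have [| |i2 d2] := IH x (itv_partition_cons ps).
- by move=> k ks; exact: (hs k.+1).
- by move=> t; rewrite in_itv /= => /andP[h1 h2]; apply: pa; rewrite in_itv /= h2 (le_trans ax h1).
have i3 : mu.-integrable `[a, b] (EFin \o path_speed alpha).
  rewrite (@itv_bndbnd_setU _ _ _ (BRight x))//.
  apply: integrable_setU => //; last first.
    by apply: integrableS i2 => //; apply: subset_itv; rewrite bnd_simp.
  apply/disj_setPS => t [] /=; rewrite !in_itv /= => /andP[_ tx] /andP[xt _].
  by move: (le_lt_trans tx xt); rewrite ltxx.
split => //; rewrite (@Rintegral_itv_add _ _ a x b)//.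
by apply: (le_trans (log_dist_triangle X (alpha x) _ _)); exact: lerD.
Qed.

End PathLength.

(** * Exponential sums, the entries of matrix power curves *)

Section ExponentialSums.
Context {R : realType} {n : nat}.
Implicit Types c l : 'I_n -> R.

(** Real and imaginary parts of the entries of [Z ** mxpow Y t ** cadj Z] have this form, with [l]
    the logarithms of the eigenvalues of [Y]. The class is stable under differentiation, which
    yields smoothness of every order. *)
Definition expsum c l (t : R) : R := \sum_k c k * expR (t * l k).

Lemma is_derive_expsum c l (t : R) :
  is_derive t (1 : R) (expsum c l) (expsum (fun k => c k * l k) l t).
Proof.
have -> : expsum c l = \sum_(k < n) (fun s => c k * expR (s * l k)).
  by apply/funext => s; rewrite fct_sumE.
rewrite /expsum; apply: is_derive_sum => k.
apply: is_derive_eq; rewrite /GRing.scale /= !(mul1r, mulr0, mulr1, addr0, mul0r); ring.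
Qed.

Lemma derive1n_expsum c l m :
  derive1n m (expsum c l) = expsum (fun k => c k * l k ^+ m) l.
Proof.
elim: m => [|m IH].
  by apply/funext => t /=; apply: eq_bigr => k _; rewrite expr0 mulr1.
apply/funext => t; rewrite derive1nS IH derive1E.
rewrite (@derive_val _ _ _ _ _ _ _ (is_derive_expsum _ _ t)).
by apply: eq_bigr => k _; rewrite exprSr mulrA.
Qed.

Lemma smooth_expsum c l : smooth_fun (expsum c l).
Proof.
move=> m t; rewrite derive1n_expsum.
exact: (@ex_derive _ _ _ _ _ _ _ (is_derive_expsum _ l t)).
Qed.

End ExponentialSums.

(** * The explicit formula for [delta] *)

Section DistanceFormula.
Context {R : realType} {d : nat}.
Local Notation mu := (@lebesgue_measure R).
Local Notation C := R[i].
Local Open Scope complex_scope.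
Implicit Types (A B M N X Y Z : 'M[C]_d).

Lemma cmul_diagRmxE M (x : 'rV[R]_d) N i j :
  (M ** diagRmx x ** N) i j = \sum_k M i k * N k j * (x 0 k)%:C.
Proof.
rewrite cmulE; apply: eq_bigr => k _; rewrite mul_mx_diagRmxE; ring.
Qed.

Lemma Im_sum (I : Type) (r : seq I) (p : pred I) (F : I -> C) :
  complex.Im (\sum_(i <- r | p i) F i) = \sum_(i <- r | p i) complex.Im (F i).
Proof. by elim/big_rec2: _ => [//|i a b _ <-]; case: (F i) b => x y [z t]. Qed.

Lemma ReImMr (z : C) (a : R) :
  complex.Re (z * a%:C) = complex.Re z * a /\ complex.Im (z * a%:C) = complex.Im z * a.
Proof. by case: z => x y /=; rewrite !mulr0 subr0 add0r. Qed.

Lemma mxpow_curve Z V (y : 'rV[R]_d) : V \is unitarymx -> (forall j, 0 < y 0 j) ->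
  let alpha t := Z ** mxpow (udiagmx V y) t ** cadj Z in
  smooth_curve alpha /\
  forall t, mxderiv alpha t =
    Z ** (mxpow (udiagmx V y) t ** mxfun (@ln R) (udiagmx V y)) ** cadj Z.
Proof.
move=> hV hy alpha.
have alphaE t : alpha t =
    (Z ** cadj V) ** diagRmx (\row_j expR (t * ln (y 0 j))) ** (V ** cadj Z).
  rewrite /alpha mxpow_udiagmx// udiagmx.unlock !cmulA; congr (_ ** diagRmx _ ** _ ** _).
  by apply/rowP => j; rewrite !mxE /powR gt_eqF.
pose c i j k := (Z ** cadj V) i k * (V ** cadj Z) k j.
pose l k := ln (y 0 k).
have reE i j : (fun s => complex.Re (alpha s i j)) = expsum (fun k => complex.Re (c i j k)) l.
  apply/funext => s; rewrite alphaE cmul_diagRmxE Re_sum; apply: eq_bigr => k _.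
  by rewrite (ReImMr _ _).1 mxE.
have imE i j : (fun s => complex.Im (alpha s i j)) = expsum (fun k => complex.Im (c i j k)) l.
  apply/funext => s; rewrite alphaE cmul_diagRmxE Im_sum; apply: eq_bigr => k _.
  by rewrite (ReImMr _ _).2 mxE.
split.
  by move=> i j; rewrite reE imE; split; exact: smooth_expsum.
move=> t.
have -> : Z ** (mxpow (udiagmx V y) t ** mxfun (@ln R) (udiagmx V y)) ** cadj Z =
    (Z ** cadj V) ** diagRmx (\row_j (expR (t * l j) * l j)) ** (V ** cadj Z).
  rewrite mxpow_udiagmx// mxfun_udiagmx// udiagmxM// udiagmx.unlock !cmulA.
  congr (_ ** diagRmx _ ** _ ** _).
  by apply/rowP => j; rewrite !mxE /powR gt_eqF.
apply/matrixP => i j; rewrite mxE cmul_diagRmxE reE imE !derive1E.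
rewrite (@derive_val _ _ _ _ _ _ _ (is_derive_expsum _ l t)).
rewrite (@derive_val _ _ _ _ _ _ _ (is_derive_expsum _ l t)).
apply/eqP; rewrite eq_complex /= Re_sum Im_sum; apply/andP; split; apply/eqP.
  by apply: eq_bigr => k _; rewrite (ReImMr _ _).1 mxE -/(c i j k); ring.
by apply: eq_bigr => k _; rewrite (ReImMr _ _).2 mxE -/(c i j k); ring.
Qed.

(** The speed is constant in [t]: the inverse of the curve times its derivative is
    [cinv (cadj Z) ** L ** cadj Z], because the power of [Y] commutes with [L] and cancels. *)
Lemma mxpow_curve_speed Z Y t : Z \in unitmx -> posdefmx Y ->
  mxspeed (Z ** mxpow Y t ** cadj Z)
          (Z ** (mxpow Y t ** mxfun (@ln R) Y) ** cadj Z) =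
  fnorm (mxfun (@ln R) Y) ^+ 2.
Proof.
move=> hZ pY; set P := mxpow Y t; set L := mxfun _ Y.
have hP : P \in unitmx by exact: mxpow_unit.
have hZ' : cadj Z \in unitmx by rewrite cadj_unit.
have hZP : Z ** P \in unitmx by rewrite cmul_unit hZ hP.
have [LE PL] : cadj L = L /\ P ** L = L ** P.
  move: pY @P @L hP hZP => /posdefmxP[V [y [hV hy ->]]] /= _ _.
  rewrite mxpow_udiagmx// mxfun_udiagmx// cadj_udiagmx !udiagmxM//; split => //.
  by congr udiagmx; apply/rowP => j; rewrite !mxE mulrC.
have key : cinv (Z ** P ** cadj Z) ** (Z ** (P ** L) ** cadj Z) =
    cinv (cadj Z) ** L ** cadj Z.
  rewrite (cinvM hZP hZ') (cinvM hZ hP) !cmulA (cmulmKV _ hZ).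
  by rewrite (cmulmKV _ hP).
have Madj : cadj (Z ** (P ** L) ** cadj Z) = Z ** (P ** L) ** cadj Z.
  by rewrite !cadjM cadjK LE (cadj_mxpow _ pY) -/P -PL !cmulA.
rewrite /mxspeed Madj key -cmulA key !cmulA (cmulmK _ hZ').
by rewrite retr_mulC !cmulA cmulmV// cmul1m fnorm_sqr ipmx_retr LE.
Qed.

(** This path, of constant speed on the unit interval, bounds the infimum from above and also shows
    that the set of lengths is nonempty, without which [inf] would be a default value. *)
Lemma exists_pd_path Z Y : Z \in unitmx -> posdefmx Y ->
  exists a b alpha, pd_path (Z ** cadj Z) (Z ** Y ** cadj Z) a b alpha /\
    path_length a b alpha = fnorm (mxfun (@ln R) Y).
Proof.
move=> hZ pY.
pose alpha t := Z ** mxpow Y t ** cadj Z.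
have [sa da] : smooth_curve alpha /\
  forall t, mxderiv alpha t = Z ** (mxpow Y t ** mxfun (@ln R) Y) ** cadj Z.
  rewrite /alpha; move: pY => /posdefmxP[V [y [hV hy ->]]]; exact: mxpow_curve.
have pa t : posdefmx (alpha t) by apply: posdefmx_congr => //; exact: posdefmx_mxpow.
exists 0, 1, alpha; split.
  split => //.
  - exists [:: 1]; first exact: itv_partition1.
    by case=> // _; exists alpha.
  - by rewrite /alpha mxpow0// cmulm1.
  - by rewrite /alpha mxpow1.
rewrite /path_length -/(path_speed alpha).
have -> : \int[mu]_(t in `[0, 1]) path_speed alpha t =
          \int[mu]_(t in `[0, 1]) fnorm (mxfun (@ln R) Y).
  apply: eq_Rintegral => t _; rewrite path_speedE// da mxpow_curve_speed//.
  by rewrite sqrtr_sqr ger0_norm ?fnorm_ge0.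
rewrite Rintegral_cst//= lebesgue_measure_itv /= lte_fin ltr01.
by rewrite sube0 /= mulr1.
Qed.

(** A normal form for two points, with [Z] the square root of [A]: [B] becomes a relative position
    [Y] seen from the identity. *)
Lemma posdefmx_pair A B : posdefmx A -> posdefmx B ->
  exists Z Y, [/\ Z \in unitmx, posdefmx Y, A = Z ** cadj Z & B = Z ** Y ** cadj Z].
Proof.
move=> pA pB; pose Z := mxpow A 2^-1.
have hZ : Z \in unitmx by exact: mxpow_unit.
have hZ' : cadj Z \in unitmx by rewrite cadj_unit.
exists Z, (cinv Z ** B ** cadj (cinv Z)); split => //.
- by apply: posdefmx_congr => //; rewrite cinv_unit.
- by rewrite cadj_mxpow// mxpow_half.
- by rewrite !cmulA cmulmV// cmul1m cadjV (cmulmKV _ hZ').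
Qed.

Lemma log_dist_le_delta X A B : X \in unitmx -> posdefmx A -> posdefmx B ->
  log_dist X A B <= delta A B.
Proof.
move=> hX pA pB; apply: lb_le_inf.
  have [Z [Y [hZ pY AE BE]]] := posdefmx_pair pA pB.
  have [a [b [alpha [h _]]]] := exists_pd_path hZ pY.
  by exists (path_length a b alpha), a, b, alpha; rewrite AE BE.
by move=> _ [a [b [alpha [h ->]]]]; exact: log_dist_le_length.
Qed.

(** For the lower bound, the chart with [X = cinv Z] sends the first point to the identity, whose
    logarithm is 0, and the second to [Y]. *)
Lemma delta_congr Z Y : Z \in unitmx -> posdefmx Y ->
  delta (Z ** cadj Z) (Z ** Y ** cadj Z) = fnorm (mxfun (@ln R) Y).
Proof.
move=> hZ pY; have hZ' : cadj Z \in unitmx by rewrite cadj_unit.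
apply/eqP; rewrite eq_le; apply/andP; split.
  have [a [b [alpha [h <-]]]] := exists_pd_path hZ pY.
  apply: ge_inf; last by exists a, b, alpha.
  exists 0 => _ [a' [b' [alpha' [_ ->]]]].
  by apply: Rintegral_ge0 => t _; exact: sqrtr_ge0.
have pA : posdefmx (Z ** cadj Z).
  by rewrite -[Z in Z ** _]cmulm1; apply: posdefmx_congr posdefmx1.
have pB : posdefmx (Z ** Y ** cadj Z) by exact: posdefmx_congr.
have hX : cinv Z \in unitmx by rewrite cinv_unit.
apply: le_trans (log_dist_le_delta hX pA pB).
rewrite /log_dist cadjV !cmulA cmulVm// !cmul1m cmulmV// (cmulmK _ hZ').
by rewrite mxfun_ln1 sub0r fnormN.
Qed.

End DistanceFormula.

(** * Metric axioms and nonpositive curvature *)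

Section Geometry.
Context {R : realType} {d : nat}.
Local Notation C := R[i].
Local Open Scope complex_scope.
Implicit Types (A B M N X Y Z : 'M[C]_d) (t : R).

(** Any factor [Z] with [Z ** cadj Z] equal to the base point is allowed, not only the Hermitian
    square root; the chart centred on a geodesic uses this freedom. *)
Lemma delta_center Z A : Z \in unitmx -> posdefmx A ->
  delta (Z ** cadj Z) A = fnorm (mxfun (@ln R) (cinv Z ** A ** cadj (cinv Z))).
Proof.
move=> hZ pA; have hZ' : cadj Z \in unitmx by rewrite cadj_unit.
rewrite -(delta_congr hZ); last by apply: posdefmx_congr => //; rewrite cinv_unit.
by rewrite !cmulA cmulmV// cmul1m cadjV (cmulmKV _ hZ').
Qed.

Lemma delta_ge0 A B : posdefmx A -> posdefmx B -> 0 <= delta A B.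
Proof.
move=> pA pB; have [Z [Y [hZ pY -> ->]]] := posdefmx_pair pA pB.
by rewrite delta_congr// fnorm_ge0.
Qed.

Lemma deltaxx A : posdefmx A -> delta A A = 0.
Proof.
move=> pA; have [Z [_ [hZ _ AE _]]] := posdefmx_pair pA pA.
have := delta_congr hZ posdefmx1; rewrite cmulm1 -AE => ->.
by rewrite mxfun_ln1 fnorm0.
Qed.

Lemma log_dist_base Z B : Z \in unitmx -> posdefmx B ->
  log_dist (cinv Z) (Z ** cadj Z) B = delta (Z ** cadj Z) B.
Proof.
move=> hZ pB; have hZ' : cadj Z \in unitmx by rewrite cadj_unit.
rewrite delta_center// /log_dist !cmulA cmulVm// cmul1m !cadjV cmulmV//.
by rewrite mxfun_ln1 sub0r fnormN.
Qed.

(** No path is reversed: in the chart centred at [P] the distance from [P] is exact, chart distance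
    is symmetric, and it is at most [delta Q P]. *)
Lemma deltaC A B : posdefmx A -> posdefmx B -> delta A B = delta B A.
Proof.
have le (P Q : 'M[C]_d) : posdefmx P -> posdefmx Q -> delta P Q <= delta Q P.
  move=> pP pQ; have [Z [_ [hZ _ PE _]]] := posdefmx_pair pP pQ.
  rewrite {1}PE -(log_dist_base hZ pQ) -PE log_distC.
  by apply: log_dist_le_delta => //; rewrite cinv_unit.
by move=> pA pB; apply/eqP; rewrite eq_le !le.
Qed.

(** No paths are concatenated: in the chart centred at [A] both distances from [A] are exact, and
    the one between [B] and [M] does not increase. *)
Lemma delta_triangle A B M : posdefmx A -> posdefmx B -> posdefmx M ->
  delta A M <= delta A B + delta B M.
Proof.
move=> pA pB pM; have [Z [_ [hZ _ AE _]]] := posdefmx_pair pA pB.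
rewrite AE -(log_dist_base hZ pB) -(log_dist_base hZ pM) -AE.
apply: (@le_trans _ _ (log_dist (cinv Z) A B + log_dist (cinv Z) B M)).
  exact: log_dist_triangle.
rewrite lerD2l.
by apply: log_dist_le_delta => //; rewrite cinv_unit.
Qed.

Lemma geodesic_spec A B t : posdefmx A -> posdefmx B ->
  exists Z Y, [/\ Z \in unitmx, posdefmx Y, A = Z ** cadj Z, B = Z ** Y ** cadj Z &
    geodesic A B t = Z ** mxpow Y t ** cadj Z].
Proof.
move=> pA pB; pose Z := mxpow A 2^-1; pose Z' := mxpow A (- 2^-1).
have zz : Z ** Z' = 1%:M by rewrite mxpowD// subrr mxpow0.
have zz' : Z' ** Z = 1%:M by rewrite mxpowD// addNr mxpow0.
exists Z, (Z' ** B ** Z'); split.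
- exact: mxpow_unit.
- have -> : Z' ** B ** Z' = Z' ** B ** cadj Z' by rewrite /Z' cadj_mxpow.
  exact: posdefmx_congr (mxpow_unit _ pA) pB.
- by rewrite (cadj_mxpow _ pA) mxpow_half.
- by rewrite cadj_mxpow// !cmulA zz cmul1m -cmulA zz' cmulm1.
- by rewrite geodesicE cadj_mxpow.
Qed.

Lemma posdefmx_geodesic A B t : posdefmx A -> posdefmx B -> posdefmx (geodesic A B t).
Proof.
move=> pA pB; have [Z [Y [hZ pY _ _ ->]]] := geodesic_spec t pA pB.
exact: posdefmx_congr hZ (posdefmx_mxpow t pY).
Qed.

Lemma delta_geodesic A B t : posdefmx A -> posdefmx B ->
  delta A (geodesic A B t) = `|t| * delta A B.
Proof.
move=> pA pB; have [Z [Y [hZ pY AE BE ->]]] := geodesic_spec t pA pB.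
rewrite {1}AE (delta_congr hZ (posdefmx_mxpow t pY)) (mxfun_lnX t pY) fnormZ.
by rewrite AE BE delta_congr.
Qed.

(** Stewart's identity in Euclidean space: the weighted mean of [- t M] and [(1 - t) M] is the
    origin. *)
Lemma fnorm_convex_identity M N t :
  (1 - t) * fnorm (- t%:C *: M - N) ^+ 2 + t * fnorm ((1 - t)%:C *: M - N) ^+ 2 =
  fnorm N ^+ 2 + t * (1 - t) * fnorm M ^+ 2.
Proof.
rewrite -rmorphN !fnorm_sqr !(ipmxDl, ipmxDr, ipmxNl, ipmxNr, ipmxZl, ipmxZr) (ipmxC N M).
ring.
Qed.

(* In the logarithmic chart centred at [geodesic A B t], the points [A] and [B]
   are [- t *: L] and [(1 - t) *: L]; distances from the centre are preserved
   and all others do not increase. *)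
Lemma delta_geodesic_npc A B M t : posdefmx A -> posdefmx B -> posdefmx M ->
  0 <= t <= 1 ->
  delta (geodesic A B t) M ^+ 2 <=
    (1 - t) * delta A M ^+ 2 + t * delta B M ^+ 2 - t * (1 - t) * delta A B ^+ 2.
Proof.
move=> pA pB pM /andP[t0 t1].
have [Z [Y [hZ pY AE BE GE]]] := geodesic_spec t pA pB.
have hZ' : cadj Z \in unitmx by rewrite cadj_unit.
(* [Z ** h] is a factor of the geodesic point. The chart of its inverse takes [A] and [B] to powers
   of the same [Y], so that their logarithms are collinear. *)
pose h := mxpow Y (t / 2); pose h' := mxpow Y (- (t / 2)).
have hh : h \in unitmx by exact: mxpow_unit.
have hadj : cadj h = h by exact: cadj_mxpow.
have h'adj : cadj h' = h' by exact: cadj_mxpow.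
have hV : cinv h = h' by exact: mxpowN.
have h2 : h ** h = mxpow Y t 
  by rewrite /h (mxpowD (t / 2) (t / 2) pY); congr (mxpow _ _); lra.
have h'2 : h' ** h' = mxpow Y (- t) 
  by rewrite /h' (mxpowD (- (t / 2)) (- (t / 2)) pY); congr (mxpow _ _); lra.
have h'Y : h' ** Y ** h' = mxpow Y (1 - t).
  transitivity (h' ** mxpow Y 1 ** h'); first by rewrite (mxpow1 pY).
  by rewrite /h' (mxpowD _ _ pY) (mxpowD _ _ pY); congr mxpow; lra.
clearbody h h'.
have hW : Z ** h \in unitmx by rewrite cmul_unit hZ hh.
pose X := cinv (Z ** h).
have XE : X = h' ** cinv Z by rewrite /X (cinvM hZ hh) hV.
have XadjE : cadj X = cinv (cadj Z) ** h' by rewrite XE cadjM cadjV h'adj.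
have hX : X \in unitmx by rewrite cinv_unit.
have GE' : geodesic A B t = (Z ** h) ** cadj (Z ** h).
  by rewrite GE cadjM hadj -h2 !cmulA.
have AX : X ** A ** cadj X = mxpow Y (- t).
  by rewrite AE XadjE XE !cmulA (cmulmKV _ hZ) (cmulmK _ hZ').
have BX : X ** B ** cadj X = mxpow Y (1 - t).
  by rewrite BE XadjE XE !cmulA (cmulmKV _ hZ) (cmulmK _ hZ').
set L := mxfun (@ln R) Y.
have dAB : delta A B = fnorm L by rewrite AE BE delta_congr.
have dG : delta (geodesic A B t) M = fnorm (mxfun (@ln R) (X ** M ** cadj X)).
  by rewrite GE' delta_center.
set c := mxfun _ _ in dG.
have dA : fnorm (- t%:C *: L - c) <= delta A M.
  apply: le_trans (log_dist_le_delta hX pA pM).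
  by rewrite /log_dist AX mxfun_lnX// rmorphN.
have dB : fnorm ((1 - t)%:C *: L - c) <= delta B M.
  apply: le_trans (log_dist_le_delta hX pB pM).
  by rewrite /log_dist BX mxfun_lnX.
have sq (x y : R) : 0 <= x -> x <= y -> x ^+ 2 <= y ^+ 2.
  by move=> x0 xy; rewrite lerXn2r// nnegrE// (le_trans x0).
rewrite dG dAB lerBrDr -fnorm_convex_identity.
apply: lerD; apply: ler_wpM2l; rewrite ?subr_ge0//; apply: sq => //; exact: fnorm_ge0.
Qed.

End Geometry.

(** * The variance inequality *)

Section BarycenterVariance.
Context {R : realType} {d : nat}.
Local Notation C := R[i].
Implicit Types (P Q G : 'M[C]_d).

Lemma ler_of_convex_bound (a b c : R) : 0 <= b ->
  (forall t, 0 < t <= 1 -> a + (1 - t) * b <= c) -> a + b <= c.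
Proof.
move=> b0 h; apply/ler_addgt0Pr => e e0.
have b1 : 0 < b + 1 by rewrite ltr_wpDl.
pose t := Num.min 1 (e / (b + 1)).
have t0 : 0 < t by rewrite lt_min ltr01 divr_gt0.
have t1 : t <= 1 by rewrite ge_min lexx.
have te : t * b <= e.
  apply: (@le_trans _ _ (e / (b + 1) * (b + 1))); last by rewrite divfK ?gt_eqF.
  by apply: ler_pM => //; [exact: ltW|rewrite ge_min lexx orbT|rewrite lerDl].
by have := h t; rewrite t0 t1 => /(_ isT); lra.
Qed.

(** Compare [G] with the nearby point [geodesic G Q t], bound each of its squared distances by
    semiparallelogram, subtract the common part, divide by [t], and let [t] tend to 0. *)
Lemma barycenter_variance (m : nat) (A : 'I_m -> 'M[C]_d) G Q :
  (forall j, posdefmx (A j)) -> is_barycenter A G -> posdefmx Q ->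
  \sum_(j < m) delta (A j) G ^+ 2 + m%:R * delta G Q ^+ 2 <=
  \sum_(j < m) delta (A j) Q ^+ 2.
Proof.
move=> pA [pG minG] pQ; apply: ler_of_convex_bound.
  by rewrite mulr_ge0// sqr_ge0.
move=> t /andP[t0 t1].
have pM : posdefmx (geodesic G Q t) by exact: posdefmx_geodesic.
have := minG _ pM.
have : \sum_(j < m) delta (A j) (geodesic G Q t) ^+ 2 <=
    \sum_(j < m) ((1 - t) * delta (A j) G ^+ 2 + t * delta (A j) Q ^+ 2 -
                  t * (1 - t) * delta G Q ^+ 2).
  apply: ler_sum => j _.
  rewrite (deltaC (pA j) pM) (deltaC (pA j) pG) (deltaC (pA j) pQ).
  by apply: delta_geodesic_npc => //; rewrite (ltW t0).
rewrite sumrB big_split /= sumr_const card_ord -[X in _ - X]mulr_natr -!mulr_sumr.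
set sG := \sum_(j < m) delta (A j) G ^+ 2; set sQ := \sum_(j < m) delta (A j) Q ^+ 2.
set D := delta G Q ^+ 2; move=> h1 /le_trans/(_ h1) h2.
by rewrite -(ler_pM2l t0); lra.
Qed.

End BarycenterVariance.

(** * Estimates for one step and for one block *)

Section InductiveMean.
Context {R : realType} {d : nat}.
Local Notation C := R[i].
Implicit Types (a : nat -> 'M[C]_d) (G : 'M[C]_d).

Lemma posdefmx_inductive_mean a n : (forall k, posdefmx (a k)) ->
  posdefmx (inductive_mean a n).
Proof.
move=> pa; elim: n => [|[|n] IH]; first exact: posdefmx1.
  exact: pa.
exact: posdefmx_geodesic IH (pa n.+2).
Qed.

Lemma inductive_meanSS a n :
  inductive_mean a n.+2 = geodesic (inductive_mean a n.+1) (a n.+2) (n.+2%:R^-1).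
Proof. by []. Qed.

(** The curvature inequality at parameter [n.+1%:R^-1], multiplied by [n.+1]. At [n = 0] the
    placeholder value of the mean has weight 0. *)
Lemma inductive_mean_step a G n : (forall k, posdefmx (a k)) -> posdefmx G ->
  n.+1%:R * delta (inductive_mean a n.+1) G ^+ 2 <=
  n%:R * delta (inductive_mean a n) G ^+ 2 + delta (a n.+1) G ^+ 2 -
  n%:R / n.+1%:R * delta (inductive_mean a n) (a n.+1) ^+ 2.
Proof.
move=> pa pG; case: n => [|n]; first by rewrite /= !mul0r mul1r add0r subr0.
rewrite inductive_meanSS.
have pS := posdefmx_inductive_mean n.+1 pa.
have n0 : 0 < n.+2%:R :> R by rewrite ltr0n.
have n1 : n.+2%:R^-1 <= 1 :> R by rewrite invf_le1// ler1n.
have := @delta_geodesic_npc _ _ _ _ G (n.+2%:R^-1) pS (pa n.+2) pG.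
rewrite invr_ge0 (ltW n0) n1 => /(_ isT).
rewrite -(ler_pM2l n0); move/le_trans; apply.
have e1 : n.+2%:R * n.+2%:R^-1 = 1 :> R by rewrite mulfV ?gt_eqF.
have e2 : n.+2%:R = n.+1%:R + 1 :> R by rewrite -natr1.
set x := delta _ G ^+ 2; set y := delta _ G ^+ 2; set z := delta _ _ ^+ 2.
move: (n.+2%:R^-1) e1 => k e1.
have -> : n.+1%:R = n.+2%:R - 1 :> R by rewrite e2 addrK.
move: (n.+2%:R) e1 => s e1.
have -> : s * ((1 - k) * x + k * y - k * (1 - k) * z) =
   (s - s * k) * x + (s * k) * y - (s * k) * (1 - k) * z by ring.
rewrite e1 (_ : (s - 1) * k = s * k - k); last by ring.
by rewrite e1 !mul1r.
Qed.

(** Let [x = 2 rho m / (n + 1)] bound the drift in a block and [y <= 2 rho] be a step distance. The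
    summands arise from [x^2] (one factor [1 / (n + 1)] being bounded by 1), from [2 x y], and from
    [y^2 / (n + r + 1)], the defect of the coefficient [(n + r) / (n + r + 1)] from 1. *)
Definition block_constant (rho : R) (m : nat) : R :=
  4 * rho ^+ 2 * (m%:R * (m%:R + 2) + 1).

Lemma block_constant_ge0 (rho : R) (m : nat) : 0 <= block_constant rho m.
Proof.
rewrite /block_constant; apply: mulr_ge0; first by rewrite mulr_ge0 ?sqr_ge0.
by rewrite addr_ge0// mulr_ge0// addr_ge0.
Qed.

Section Bounded.
Context (a : nat -> 'M[C]_d) (G : 'M[C]_d) (rho : R)
  (pa : forall k, posdefmx (a k)) (pG : posdefmx G)
  (rho0 : 0 <= rho) (arho : forall k, delta (a k) G <= rho).

Let S := inductive_mean a.
Let pS n : posdefmx (S n). Proof. exact: posdefmx_inductive_mean. Qed.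

(** The step inequality without its subtracted term, summed. With [n = 0] it gives boundedness;
    later it covers the incomplete last block. *)
Lemma inductive_mean_linear n r :
  (n + r)%:R * delta (S (n + r)) G ^+ 2 <= n%:R * delta (S n) G ^+ 2 + r%:R * rho ^+ 2.
Proof.
elim: r => [|r IH]; first by rewrite addn0 mul0r addr0.
rewrite addnS; apply: (le_trans (inductive_mean_step (n + r) pa pG)).
have h1 : delta (a (n + r).+1) G ^+ 2 <= rho ^+ 2.
  by rewrite lerXn2r// nnegrE delta_ge0.
have h2 : 0 <= (n + r)%:R / (n + r).+1%:R * delta (S (n + r)) (a (n + r).+1) ^+ 2.
  by rewrite mulr_ge0 ?sqr_ge0// divr_ge0.
rewrite -[r.+1%:R]natr1 mulrDl mul1r addrA.
by rewrite lerBlDr (le_trans (lerD IH h1))// lerDl.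
Qed.

Lemma inductive_mean_bounded n : (0 < n)%N -> delta (S n) G <= rho.
Proof.
move=> n0; have := inductive_mean_linear 0 n; rewrite add0n mul0r add0r.
by rewrite ler_pM2l ?ltr0n// ler_pXn2r// nnegrE delta_ge0.
Qed.

Lemma inductive_mean_diam n k : (0 < n)%N -> delta (S n) (a k) <= 2 * rho.
Proof.
move=> n0; apply: (le_trans (delta_triangle (pS n) pG (pa k))).
rewrite (deltaC pG (pa k)).
have := inductive_mean_bounded n0; have := arho k; lra.
Qed.

(** A step covers the fraction [1 / (n + r + 1)] of a distance at most [2 * rho]. *)
Lemma inductive_mean_drift n r : (0 < n)%N ->
  delta (S n) (S (n + r)) <= r%:R * (2 * rho / n.+1%:R).
Proof.
case: n => // n _; elim: r => [|r IH]; first by rewrite addn0 mul0r deltaxx.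
rewrite addnS; apply: (le_trans (delta_triangle (pS n.+1) (pS (n.+1 + r)) (pS _))).
rewrite -natr1 mulrDl mul1r; apply: lerD => //.
rewrite addSn /S inductive_meanSS (delta_geodesic _ (pS (n + r).+1) (pa _)).
rewrite ger0_norm ?invr_ge0// mulrC; apply: ler_pM => //.
- by apply: delta_ge0 => //; exact: pS.
- exact: inductive_mean_diam.
by rewrite lef_pV2 ?posrE ?ltr0n// ler_nat !ltnS leq_addr.
Qed.

(* The base point [S (n + r)] of a step is replaced by the base point [S n] of
   the block, at a cost of order [1 / n]. *)
Lemma inductive_mean_block_step m n r : (0 < n)%N -> (r < m)%N ->
  (n + r).+1%:R * delta (S (n + r).+1) G ^+ 2 <=
  (n + r)%:R * delta (S (n + r)) G ^+ 2 + delta (a (n + r).+1) G ^+ 2 -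
  delta (a (n + r).+1) (S n) ^+ 2 + block_constant rho m / n.+1%:R.
Proof.
move=> n0 rm; apply: (le_trans (inductive_mean_step (n + r) pa pG)).
rewrite -!addrA lerD2l lerD2l /S; set y := delta _ (a (n + r).+1).
have nr0 : (0 < n + r)%N by rewrite addn_gt0 n0.
have y0 : 0 <= y by exact: delta_ge0.
have y2 : y <= 2 * rho by exact: inductive_mean_diam.
have i0 : 0 < n.+1%:R^-1 :> R by rewrite invr_gt0 ltr0n.
have i1 : n.+1%:R^-1 <= 1 :> R by rewrite invf_le1 ?ltr0n// ler1n.
have j0 : 0 < (n + r).+1%:R^-1 :> R by rewrite invr_gt0 ltr0n.
have ji : (n + r).+1%:R^-1 <= n.+1%:R^-1 :> R.
  by rewrite lef_pV2 ?posrE ?ltr0n// ler_nat ltnS leq_addr.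
have -> : (n + r)%:R / (n + r).+1%:R = 1 - (n + r).+1%:R^-1 :> R.
  by rewrite -[X in X / _](addrK 1) natr1 mulrBl mul1r divff.
pose z := delta (a (n + r).+1) (inductive_mean a n).
have z0 : 0 <= z by exact: delta_ge0.
have zle : z <= y + 2 * rho * m%:R * n.+1%:R^-1.
  rewrite /z deltaC//; apply: (le_trans (delta_triangle (pS n) (pS (n + r)) (pa _))).
  rewrite addrC lerD2l; apply: (le_trans (inductive_mean_drift r n0)).
  rewrite (_ : 2 * rho * m%:R / n.+1%:R = m%:R * (2 * rho / n.+1%:R)); last by ring.
  apply: ler_wpM2r; first by rewrite mulr_ge0 ?mulr_ge0// ltW.
  by rewrite ler_nat ltnW.
rewrite -/z /block_constant; move: (n.+1%:R^-1) i0 i1 ((n + r).+1%:R^-1) j0 ji zle.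
move=> i i0 i1 j j0 ji zle; have m0 : 0 <= m%:R :> R by [].
pose x := 2 * rho * m%:R * i; rewrite -/x in zle.
have x0 : 0 <= x by rewrite /x !mulr_ge0// ltW.
have h1 : z ^+ 2 <= (y + x) ^+ 2 by rewrite lerXn2r// nnegrE addr_ge0.
have h2 : x * y <= x * (2 * rho) by exact: ler_wpM2l.
have h3 : x ^+ 2 <= 4 * rho ^+ 2 * m%:R ^+ 2 * i.
  have -> : x ^+ 2 = 4 * rho ^+ 2 * m%:R ^+ 2 * i * i by rewrite /x; ring.
  by rewrite ler_piMr// !mulr_ge0 ?sqr_ge0// ltW.
have h4 : j * y ^+ 2 <= i * (4 * rho ^+ 2).
  apply: ler_pM; [exact: ltW|exact: sqr_ge0|exact: ji|].
  have -> : 4 * rho ^+ 2 = (2 * rho) ^+ 2 by ring.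
  by rewrite lerXn2r// nnegrE mulr_ge0.
have -> : 4 * rho ^+ 2 * (m%:R * (m%:R + 2) + 1) * i =
  4 * rho ^+ 2 * m%:R ^+ 2 * i + 2 * (x * (2 * rho)) + i * (4 * rho ^+ 2).
  by rewrite /x; ring.
rewrite sqrrD in h1; lra.
Qed.

End Bounded.

End InductiveMean.

(** * Complete blocks and the rate *)

Section PermutedSequence.
Context {R : realType} {d m : nat} (hm : (0 < m)%N).
Local Notation C := R[i].
Context (A : 'I_m -> 'M[C]_d) (G : 'M[C]_d) (sigma : nat -> {perm 'I_m})
  (hA : forall j, posdefmx (A j)) (hG : is_barycenter A G).

Lemma permuted_seqE q r (rm : (r < m)%N) :
  permuted_seq hm A sigma (q * m + r).+1 = A (sigma q.+1 (Ordinal rm)).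
Proof.
rewrite /permuted_seq /= divnMDl// divn_small// addn0; congr (A (sigma _ _)).
by apply: val_inj; rewrite /= modnMDl modn_small.
Qed.

Let a := permuted_seq hm A sigma.
(** A sum dominates each distance as well as a maximum would, and does not involve [sigma]. *)
Let rho : R := \sum_j delta (A j) G.
Let e n : R := delta (inductive_mean a n) G ^+ 2.
Let K : R := block_constant rho m.

Let pG : posdefmx G. Proof. by case: hG. Qed.
Let pa k : posdefmx (a k). Proof. exact: hA. Qed.
Let pS n : posdefmx (inductive_mean a n). Proof. exact: posdefmx_inductive_mean. Qed.
Let rho0 : 0 <= rho.
Proof. by apply: sumr_ge0 => j _; exact: delta_ge0. Qed.
Let arho k : delta (a k) G <= rho.
Proof.
rewrite /rho (bigD1 (sigma (k.-1 %/ m).+1 (Ordinal (ltn_pmod k.-1 hm))))//=.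
by rewrite lerDl; apply: sumr_ge0 => j _; exact: delta_ge0.
Qed.
Let K0 : 0 <= K. Proof. exact: block_constant_ge0. Qed.

Lemma inductive_mean_block_partial q r : (0 < q)%N -> (r <= m)%N ->
  (q * m + r)%:R * e (q * m + r) <= (q * m)%:R * e (q * m) +
  \sum_(i < r) (delta (a (q * m + i).+1) G ^+ 2 -
                delta (a (q * m + i).+1) (inductive_mean a (q * m)) ^+ 2) +
  r%:R * (K / (q * m).+1%:R).
Proof.
move=> q0; elim: r => [|r IH] rm; first by rewrite addn0 big_ord0 mul0r !addr0.
have n0 : (0 < q * m)%N by rewrite muln_gt0 q0.
have h := inductive_mean_block_step pa pG rho0 arho n0 rm.
have {}IH := IH (ltnW rm).
rewrite addnS big_ord_recr /= -[r.+1%:R]natr1 mulrDl mul1r.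
move: h IH; rewrite -/K /e.
move: (_ * delta _ G ^+ 2) (_ * delta _ G ^+ 2) (_ * delta _ G ^+ 2).
move: (delta _ G ^+ 2) (delta _ (inductive_mean a (q * m)) ^+ 2) (\sum_(_ < _) _).
move: (K / _) (r%:R * _) => c1 c2 x1 x2 x3 x4 x5 x6; lra.
Qed.

(** The coefficient [q - 1] comes from [q * m] copies of the old error minus the [m] copies supplied
    by the variance inequality; the factor [m] then cancels. *)
Lemma inductive_mean_block q : (0 < q)%N ->
  q.+1%:R * e (q.+1 * m) <= (q%:R - 1) * e (q * m) + K / (q * m).+1%:R.
Proof.
move=> q0; have := inductive_mean_block_partial q0 (leqnn m).
have m0 : 0 < m%:R :> R by rewrite ltr0n.
have -> : \sum_(i < m) (delta (a (q * m + i).+1) G ^+ 2 -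
      delta (a (q * m + i).+1) (inductive_mean a (q * m)) ^+ 2) =
    \sum_(j < m) delta (A j) G ^+ 2 -
    \sum_(j < m) delta (A j) (inductive_mean a (q * m)) ^+ 2.
  (* Here the permutation disappears: one block runs through every index exactly once. *)
  rewrite -sumrB [RHS](reindex_inj (@perm_inj _ (sigma q.+1))) /=.
  apply: eq_bigr => i _; rewrite /a (permuted_seqE q (ltn_ord i)).
  by have -> : Ordinal (ltn_ord i) = i by exact: val_inj.
have := barycenter_variance hA hG (pS (q * m)).
rewrite (deltaC pG (pS _)) -/(e (q * m)) -mulSnr !natrM => hv hs.
rewrite -(ler_pM2l m0); move: hv hs.
move: (e _) (e _) (\sum_(j < m) _) (\sum_(j < m) _) (K / _) => x y sG sS c.
lra.
Qed.

Lemma inductive_mean_multiples p : p.+1%:R * e (p.+1 * m) <= K + rho ^+ 2.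
Proof.
have z : p%:R * (p.+1%:R * e (p.+1 * m)) <= p%:R * K.
  elim: p => [|p IH]; first by rewrite !mul0r.
  have := inductive_mean_block (ltn0Sn p).
  have p0 : 0 < p.+1%:R :> R by rewrite ltr0n.
  have -> : p.+1%:R - 1 = p%:R :> R by rewrite -natr1 addrK.
  rewrite -(ler_pM2l p0) => /le_trans; apply.
  have h : p.+1%:R * (K / (p.+1 * m).+1%:R) <= K.
    rewrite mulrCA ler_piMr// ler_pdivrMr ?ltr0n// mul1r ler_nat.
    by rewrite ltnW// ltnS leq_pmulr.
  rewrite mulrDr mulrCA -[in leRHS]natr1 [in leRHS]mulrDl mul1r; exact: lerD.
(* For [p = 0] the telescoped bound is void; the end of the first block is bounded by [rho], whence
   the summand [rho ^+ 2]. *)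
case: p z => [_|p].
  have := inductive_mean_bounded pa pG rho0 arho (n := (1 * m)%N).
  rewrite mul1n => /(_ hm) h; rewrite mul1r ler_wpDl// /e.
  by rewrite lerXn2r// nnegrE delta_ge0.
by rewrite ler_pM2l ?ltr0n// => /le_trans; apply; rewrite lerDl sqr_ge0.
Qed.

(** Complete blocks contribute [m * (K + rho ^+ 2)], the fewer than [m] remaining steps at most
    [m * rho ^+ 2]. *)
Lemma inductive_mean_rate n : n%:R * e n <= m%:R * (K + 2 * rho ^+ 2).
Proof.
have m0 : 0 <= m%:R :> R by [].
have r2 : 0 <= rho ^+ 2 by rewrite sqr_ge0.
rewrite (divn_eq n m); set r := (n %% m)%N.
have rm : r%:R * rho ^+ 2 <= m%:R * rho ^+ 2.
  by rewrite ler_wpM2r// ler_nat ltnW// ltn_pmod.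
have mK : 0 <= m%:R * K by rewrite mulr_ge0.
have := inductive_mean_linear pa pG rho0 arho (n %/ m * m) r.
move=> /le_trans; apply; case: (n %/ m)%N => [|p].
  by rewrite mul0n mul0r add0r; have := mulr_ge0 m0 r2; lra.
have := ler_wpM2l m0 (inductive_mean_multiples p).
by rewrite -/a -/(e _) natrM; move: (e _) => x; lra.
Qed.

End PermutedSequence.

(** * From [delta] to the topology of matrices *)

Section Convergence.
Context {R : realType} {d : nat}.
Local Notation C := R[i].
Local Open Scope complex_scope.
Implicit Types (G Y : 'M[C]_d) (S : nat -> 'M[C]_d).

Lemma fnorm_udiagmx_sqr (V : 'M[C]_d) (x : 'rV[R]_d) : V \is unitarymx ->
  fnorm (udiagmx V x) ^+ 2 = \sum_j x 0 j ^+ 2.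
Proof.
move=> hV; rewrite udiagmx.unlock fnorm_unitary; last 2 first.
- by rewrite cadjK unitary_cmulV.
- exact: unitary_cmulV.
rewrite fnorm_sqr ipmxE; apply: eq_bigr => i _.
rewrite (bigD1 i)//= big1 => [|j ji]; rewrite diagRmxE.
  by rewrite eqxx mulr1n Re_mul_conj /= expr0n /= !addr0.
by rewrite eq_sym (negbTE ji) mulr0n mul0r.
Qed.

Lemma fnorm_sub1_le_ln Y : posdefmx Y -> fnorm (mxfun (@ln R) Y) <= 2^-1 ->
  fnorm (Y - 1%:M) <= 2 * fnorm (mxfun (@ln R) Y).
Proof.
move=> /posdefmxP[V [y [hV hy ->]]]; rewrite mxfun_udiagmx// => hL.
have sub1 : udiagmx V y - 1%:M = udiagmx V (map_mx (fun r => r - 1) y).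
  rewrite -(udiagmx1 hV) udiagmx.unlock -cmulBl -cmulBr; congr (_ ** _ ** _).
  by apply/matrixP => i j; rewrite !mxE !diagRmxE !mxE -mulrnBl rmorphB.
have lny j : `|ln (y 0 j)| <= 2^-1.
  apply: le_trans hL; rewrite -(@ler_pXn2r _ 2)// ?nnegrE ?fnorm_ge0//.
  rewrite fnorm_udiagmx_sqr// real_normK ?num_real// (bigD1 j)//= mxE lerDl.
  by apply: sumr_ge0 => k _; exact: sqr_ge0.
rewrite -(@ler_pXn2r _ 2)// ?nnegrE ?mulr_ge0 ?fnorm_ge0//.
rewrite sub1 exprMn !fnorm_udiagmx_sqr// mulr_sumr; apply: ler_sum => j _.
rewrite !mxE -[leLHS]real_normK ?num_real// -[X in _ * X]real_normK ?num_real//.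
rewrite -exprMn ler_pXn2r// ?nnegrE ?mulr_ge0//.
exact: normr_sub1_le_ln.
Qed.

(** Writing [G = Z ** cadj Z], the distance to [G] is the norm of the logarithm of [Y n]; hence
    [Y n] tends to the identity, and the congruence by [Z] carries this back to [S n]. *)
Lemma delta_cvg_fnorm S G : (forall n, posdefmx (S n)) -> posdefmx G ->
  delta (S n) G @[n --> \oo] --> 0 -> fnorm (S n - G) @[n --> \oo] --> 0.
Proof.
move=> pS pG hd; have [Z [_ [hZ _ GE _]]] := posdefmx_pair pG pG.
have hZ' : cadj Z \in unitmx by rewrite cadj_unit.
pose Y n := cinv Z ** S n ** cadj (cinv Z).
have pY n : posdefmx (Y n) by apply: posdefmx_congr => //; rewrite cinv_unit.
have dE n : delta (S n) G = fnorm (mxfun (@ln R) (Y n)).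
  by rewrite deltaC// {1}GE delta_center.
have SE n : S n = Z ** Y n ** cadj Z.
  by rewrite /Y !cmulA cmulmV// cmul1m cadjV (cmulmKV _ hZ').
have Y1 : fnorm (Y n - 1%:M) @[n --> \oo] --> 0.
  have h2 : 0 < 2^-1 :> R by [].
  apply: (@squeeze_cvgr _ _ _ _ (fun=> 0) (fun n => 2 * delta (S n) G)).
  - move/cvgr0_norm_le : hd => /(_ _ h2); apply: filterS => n.
    rewrite dE ger0_norm ?fnorm_ge0// => h.
    exact: fnorm_sub1_le_ln.
  - exact: cvg_cst.
  by rewrite -(mulr0 2); apply: cvgM => //; exact: cvg_cst.
rewrite (_ : (fun n => _) = (fun n => fnorm (Z ** Y n ** cadj Z - Z ** 1%:M ** cadj Z))).
  apply: fnorm_cvgM; last exact: fnorm_cvg_cst.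
  by apply: fnorm_cvgM => //; exact: fnorm_cvg_cst.
by apply/funext => n; rewrite -SE cmulm1 -GE.
Qed.

Lemma fnorm_cvg_mx S G : fnorm (S n - G) @[n --> \oo] --> 0 ->
  (fun n => S n : 'M[R[i]^o]_d) @ \oo --> (G : 'M[R[i]^o]_d).
Proof.
move=> h; apply/cvg_ballP => e e0.
(* The radius [e] lives in [R[i]]; being positive it is real. *)
have er : (complex.Re e)%:C = e by rewrite RRe_real// gtr0_real.
have e1 : 0 < complex.Re e by rewrite -ltcR er.
move/cvgr0_norm_lt : h => /(_ _ e1); apply: filterS => n.
rewrite ger0_norm ?fnorm_ge0// => hn; split=> // i j.
rewrite /ball /= distrC.
have -> : S n i j - G i j = (S n - G) i j by rewrite !mxE.
rewrite -er; apply: le_lt_trans (_ : (fnorm (S n - G))%:C < _); last by rewrite ltcR.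
by have := normc_le_fnorm (S n - G) i j; rewrite -lecR.
Qed.

End Convergence.

Theorem theorem1p4 (R : realType) (d m : nat) (hm : (0 < m)%N)
    (A : 'I_m -> 'M[R[i]]_d) (G : 'M[R[i]]_d)
    (hA : forall j, posdefmx (A j)) (hG : is_barycenter A G) :
  exists2 L : R, 0 < L &
    forall sigma : nat -> {perm 'I_m},
      (forall n : nat, (1 <= n)%N ->
         (delta (inductive_mean (permuted_seq hm A sigma) n) G) ^+ 2
           <= L / n%:R) /\
      ((fun n => inductive_mean (permuted_seq hm A sigma) n : 'M[R[i]^o]_d)
         @ \oo --> (G : 'M[R[i]^o]_d)).
Proof.
have [pG _] := hG.
set rho : R := \sum_j delta (A j) G.
(* The summand 1 secures [0 < L] when all [A j] coincide and [rho] is 0. *)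
pose L : R := m%:R * (block_constant rho m + 2 * rho ^+ 2) + 1.
have L0 : 0 < L.
  apply: ltr_wpDl; last exact: ltr01.
  by rewrite mulr_ge0// addr_ge0 ?block_constant_ge0// mulr_ge0// sqr_ge0.
exists L => // sigma.
have rate n : (1 <= n)%N ->
    delta (inductive_mean (permuted_seq hm A sigma) n) G ^+ 2 <= L / n%:R.
  move=> n0; rewrite ler_pdivlMr ?ltr0n// mulrC.
  by apply: (le_trans (inductive_mean_rate hm sigma hA hG n)); rewrite lerDl.
split=> //; apply: fnorm_cvg_mx.
have pS n : posdefmx (inductive_mean (permuted_seq hm A sigma) n).
  by apply: posdefmx_inductive_mean => k; exact: hA.
apply: delta_cvg_fnorm => //.
have d2 : delta (inductive_mean (permuted_seq hm A sigma) n) G ^+ 2 @[n --> \oo] --> 0.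
  apply: (@squeeze_cvgr _ _ _ _ (fun=> 0) (fun n => L * n%:R^-1)).
  - near=> n; rewrite sqr_ge0 /=; apply: rate; near: n; exact: nbhs_infty_ge.
  - exact: cvg_cst.
  rewrite -(mulr0 L); apply: cvgM; first exact: cvg_cst.
  by rewrite -cvg_shiftS; exact: cvg_harmonic.
rewrite (_ : (fun n => _) = (fun n => Num.sqrt
   (delta (inductive_mean (permuted_seq hm A sigma) n) G ^+ 2))).
  rewrite -sqrtr0; apply: (@continuous_cvg _ _ _ _ _ _ Num.sqrt) => //.
  exact: sqrt_continuous.
by apply/funext => n; rewrite sqrtr_sqr ger0_norm// delta_ge0.
Unshelve. all: by end_near. Qed.
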